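(* Let $M$ be a connected $C^\infty$ manifold without boundary endowed with a complete Riemannian metric, let $H:T^*M\to\mathbb{R}$ be a $C^2$ function which is uniformly superlinear, uniformly bounded and $C^2$-strictly convex in the fibers, and let $G$ be a group acting on $M$ by diffeomorphisms which preserve $H$, in the sense that for all $g\in G$, $x\in M$ and $p\in T^*_{g(x)}M$ one has $H(g(x),p)=H(x,p\circ d_xg)$. Then there is a constant $c_{inv}(H)\in\mathbb{R}$ such that the Hamilton-Jacobi equation $H(x,d_xu)=c$ admits a $G$-invariant global viscosity solution $u:M\to\mathbb{R}$ for $c=c_{inv}(H)$ and does not admit any such ($G$-invariant global viscosity) solution for $c<c_{inv}(H)$.
   Context: $\|\cdot\|$ denotes the norm on $T_xM$ given by the Riemannian metric and also the dual norm on $T^*_xM$. Conditions on $H$: - Uniform superlinearity: for every $K\ge 0$ there exists $C^*(K)\in\mathbb{R}$ such that $H(x,p)\ge K\|p\|-C^*(K)$ for all $(x,p)\in T^*M$. - Uniform boundedness: for every $R\ge 0$, $A^*(R)=\sup\{H(x,p)\mid \|p\|\le R\}<+\infty$. - $C^2$-strict convexity in the fibers: for every $(x,p)\in T^*M$, $\partial^2H/\partial p^2(x,p)$ is positive definite. $u$ is $G$-invariant if $u(g(x))=u(x)$ for all $g\in G$, $x\in M$ (the element $g$ and its associated diffeomorphism are denoted by the same letter). Viscosity solutions: a continuous function $u:M\to\mathbb{R}$ is a viscosity subsolution (resp. supersolution) of $H(x,d_xu)=c$ if for each $C^1$ function $\phi:M\to\mathbb{R}$ such that $u-\phi$ admits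 a maximum (resp. minimum) at some $x_0\in M$, one has $H(x_0,d_{x_0}\phi)\le c$ (resp. $H(x_0,d_{x_0}\phi)\ge c$). It is a (global) viscosity solution if it is both. *)

(* Defs.v *)
From HB Require Import structures.
From mathcomp Require Import all_boot all_order all_algebra.
From mathcomp Require Import all_classical all_reals all_analysis.

Set Implicit Arguments.
Unset Strict Implicit.
Unset Printing Implicit Defensive.

Import Order.TTheory GRing.Theory Num.Theory.
Import numFieldNormedType.Exports.

Local Open Scope classical_set_scope.
Local Open Scope ring_scope.

(* Tangent vectors are row vectors, covectors are column vectors, and linear
   maps act by right multiplication on row vectors, as for ['J f p]. *)

Section Euclidean.
Context {R : realType}.

(* Only meant for open [D]: derivatives are taken in the ambient space. *)
Fixpoint Ck_on (k : nat) {V W : normedModType R} (f : V -> W) (D : set V)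
    : Prop :=
  match k with
  | 0 => forall x, D x -> {for x, continuous f}
  | k'.+1 => (forall x, D x -> differentiable f x) /\
             (forall v : V, Ck_on k' ('D_v f) D)
  end.

Definition smooth_on {V W : normedModType R} (f : V -> W) (D : set V) : Prop :=
  forall k, Ck_on k f D.

Definition posdef (n : nat) (S : 'M[R]_n) : Prop :=
  forall v : 'rV[R]_n, v != 0 -> 0 < (v *m S *m v^T) 0 0.

Definition hessian (n : nat) (f : 'cV[R]_n -> R) (p : 'cV[R]_n) : 'M[R]_n :=
  \matrix_(i, j) 'D_(delta_mx i 0) ('D_(delta_mx j 0) f) p.

End Euclidean.

Section Manifold.
Context {R : realType} {n : nat} {M : topologicalType}.

Record chart := Chart {
  cdom : set M;
  cmap : M -> 'rV[R]_n;
  cinv : 'rV[R]_n -> M;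
  cdom_open : open cdom;
  cimg_open : open (cmap @` cdom);
  cmapK : forall x, cdom x -> cinv (cmap x) = x;
  cmap_continuous : forall x, cdom x -> {for x, continuous cmap};
  cinv_continuous : forall y, (cmap @` cdom) y -> {for y, continuous cinv}
}.

Definition cimg (c : chart) : set 'rV[R]_n := cmap c @` cdom c.

Record smooth_atlas := SmoothAtlas {
  charts : set chart;
  charts_cover : forall x, exists c, charts c /\ cdom c x;
  charts_smooth : forall c d, charts c -> charts d ->
    smooth_on (cmap d \o cinv c) (cmap c @` (cdom c `&` cdom d))
}.

End Manifold.

Arguments chart R n M : clear implicits.
Arguments smooth_atlas R n M : clear implicits.

Definition chart_at (R : realType) (n : nat) (M : topologicalType)
    (A : smooth_atlas R n M) (x : M) : chart R n M :=
  sval (cid (charts_cover A x)).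

(* T_xM is identified with R^n through the chart [chart_at A x]; the other
   charts act on it through [dchart], the differential at x of the chart. *)
Definition tangent (R : realType) (n : nat) (M : topologicalType)
  (A : smooth_atlas R n M) (x : M) : Type := 'rV[R]_n.

Definition cotangent (R : realType) (n : nat) (M : topologicalType)
  (A : smooth_atlas R n M) (x : M) : Type := 'cV[R]_n.

Section TangentSpaces.
Context {R : realType} {n : nat} {M : topologicalType}
  (A : smooth_atlas R n M).

Definition pairing (x : M) (p : cotangent A x) (v : tangent A x) : R :=
  (v *m p) 0 0.

Definition dchart (c : chart R n M) (x : M) : 'M[R]_n :=
  'J (cmap c \o cinv (chart_at A x)) (cmap (chart_at A x) x).

(* the inverse of [dchart c x] when x = cinv c y *)
Definition dchart_inv (c : chart R n M) (y : 'rV[R]_n) : 'M[R]_n :=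
  'J (cmap (chart_at A (cinv c y)) \o cinv c) y.

Definition C1_function (phi : M -> R) : Prop :=
  forall c, charts A c -> Ck_on 1 (phi \o cinv c : 'rV[R]_n -> R^o) (cimg c).

Definition dfun (phi : M -> R) (x : M) : cotangent A x :=
  \col_i 'd (phi \o cinv (chart_at A x) : 'rV[R]_n -> R^o)
            (cmap (chart_at A x) x) (delta_mx 0 i).

Definition smooth_map (f : M -> M) : Prop :=
  continuous f /\
  forall c d, charts A c -> charts A d ->
    smooth_on (cmap d \o f \o cinv c) (cmap c @` (cdom c `&` f @^-1` cdom d)).

Definition diffeomorphism (f : M -> M) : Prop :=
  smooth_map f /\
  exists f', [/\ cancel f f', cancel f' f & smooth_map f'].

Definition dmap (f : M -> M) (x : M) : 'M[R]_n :=
  'J (cmap (chart_at A (f x)) \o f \o cinv (chart_at A x))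
     (cmap (chart_at A x) x).

(* p \o d_x f *)
Definition pullback (f : M -> M) (x : M) (p : cotangent A (f x)) :
    cotangent A x :=
  dmap f x *m p.

Definition C1_curve (gamma : R -> M) : Prop :=
  continuous gamma /\
  forall c, charts A c -> Ck_on 1 (cmap c \o gamma : R^o -> 'rV[R]_n)
                         (gamma @^-1` cdom c).

Definition velocity (gamma : R -> M) (t : R) : tangent A (gamma t) :=
  derive1 (cmap (chart_at A (gamma t)) \o gamma) t.

Record riemannian_metric := RiemannianMetric {
  gram : M -> 'M[R]_n;
  gram_sym : forall x, (gram x)^T = gram x;
  gram_posdef : forall x, posdef (gram x);
  gram_smooth : forall c, charts A c ->
    smooth_on (fun y => dchart_inv c y *m gram (cinv c y) *m (dchart_inv c y)^T)
              (cimg c)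
}.

Section Metric.
Variable g : riemannian_metric.

Definition tnorm (x : M) (v : tangent A x) : R :=
  Num.sqrt ((v *m gram g x *m v^T) 0 0).

Definition dual_norm (x : M) (p : cotangent A x) : R :=
  sup [set `|pairing p v| | v in [set v : tangent A x | tnorm v <= 1]].

Definition curve_length (gamma : R -> M) : \bar R :=
  (\int[lebesgue_measure]_(t in `[0%R, 1%R]) (tnorm (velocity gamma t))%:E)%E.

(* Allowing piecewise C^1 curves would give the same infimum: a piecewise C^1
   curve can be reparametrized so as to stop at its corners. *)
Definition riemannian_dist (x y : M) : \bar R :=
  ereal_inf [set curve_length gamma | gamma in
    [set gamma | [/\ C1_curve gamma, gamma 0 = x & gamma 1 = y]]].

Definition complete_metric : Prop :=
  forall u : nat -> M,
    (forall e : R, 0 < e -> exists N : nat, forall i j : nat,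
       (N <= i)%N -> (N <= j)%N -> (riemannian_dist (u i) (u j) < e%:E)%E) ->
    exists l : M, forall e : R, 0 < e -> exists N : nat, forall i : nat,
       (N <= i)%N -> (riemannian_dist (u i) l < e%:E)%E.

End Metric.

Definition hamiltonian : Type := forall x : M, cotangent A x -> R.

Section Hamiltonian.
Variable H : hamiltonian.

(* [H] is C^2 in the coordinates (y, q) on T^*M associated with each chart *)
Definition C2_hamiltonian : Prop :=
  forall c, charts A c ->
    Ck_on 2 (fun yq : 'rV[R]_n * 'cV[R]_n =>
               @H (cinv c yq.1) (dchart c (cinv c yq.1) *m yq.2) : R^o)
            (cimg c `*` [set: 'cV[R]_n]).

Definition uniformly_superlinear (g : riemannian_metric) : Prop :=
  forall K : R, 0 <= K -> exists C : R, forall (x : M) (p : cotangent A x),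
    @H x p >= K * dual_norm g p - C.

Definition uniformly_bounded (g : riemannian_metric) : Prop :=
  forall r : R, 0 <= r ->
    (ereal_sup [set z : \bar R | exists (x : M) (p : cotangent A x),
                  (dual_norm g p <= r)%R /\ z = (@H x p)%:E] < +oo)%E.

Definition C2_strictly_convex : Prop :=
  forall (x : M) (p : cotangent A x), posdef (hessian (@H x) p).

Definition preserves (f : M -> M) : Prop :=
  forall (x : M) (p : cotangent A (f x)), @H (f x) p = @H x (pullback p).

Definition viscosity_subsolution (c : R) (u : M -> R) : Prop :=
  continuous u /\
  forall (phi : M -> R) (x0 : M), C1_function phi ->
    (forall x, u x - phi x <= u x0 - phi x0) -> @H x0 (dfun phi x0) <= c.

Definition viscosity_supersolution (c : R) (u : M -> R) : Prop :=
  continuous u /\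
  forall (phi : M -> R) (x0 : M), C1_function phi ->
    (forall x, u x0 - phi x0 <= u x - phi x) -> @H x0 (dfun phi x0) >= c.

Definition viscosity_solution (c : R) (u : M -> R) : Prop :=
  viscosity_subsolution c u /\ viscosity_supersolution c u.

End Hamiltonian.

End TangentSpaces.

Section GroupAction.
Context {G : groupType} {M : Type} (act : G -> M -> M).

Definition is_group_action : Prop :=
  (forall x, act 1%g x = x) /\
  (forall a b x, act (a * b)%g x = act a (act b x)).

Definition invariant_function {R : Type} (u : M -> R) : Prop :=
  forall a x, u (act a x) = u x.

End GroupAction.

(* Main.v *)
(* Let c be the infimum of the levels at which there is a G-invariant viscosity
   subsolution. Coercivity makes subsolutions locally equi-Lipschitz, so by
   stability under locally uniform limits there is such a subsolution v at level
   c. For lam > 0 let u_lam be the largest subsolution (Perron) of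
   lam (u - v) + H(x, du) <= c above v: it solves the equation, it is invariant
   because it is the largest one, it is a subsolution of H <= c, and
   0 <= lam (u_lam - v) <= c - inf H. As lam -> 0 along an ultrafilter,
   u_lam - u_lam(x0) tends to an invariant solution of H = c - b, where
   b = lim lam (u_lam - v)(x0) >= 0, and minimality of c forces b = 0. Working
   with v instead of 0 in the discounted equation is what makes the limit level
   not exceed c when M is not compact. *)

Require Import Defs.
From HB Require Import structures.
From mathcomp Require Import all_boot all_order all_algebra.
From mathcomp Require Import all_classical all_reals all_analysis.
From mathcomp Require Import ring lra.
Set Implicit Arguments.
Unset Strict Implicit.
Unset Printing Implicit Defensive.
Import Order.TTheory GRing.Theory Num.Theory.
Import numFieldNormedType.Exports.
Local Open Scope classical_set_scope.
Local Open Scope ring_scope.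

(** * Gradients and C^1 functions on R^n *)

(** The viscosity notions of the statement test against functions that are C^1 on all of [M] and
    compare on all of [M], whereas the arguments produce test functions only near a point. The work
    is therefore done with the local notions [lsub] and [lsuper]. Local implies global at once; the
    converse, for subsolutions, extends a germ to a global C^1 function above [u] ([global_test], by
    second countability), and it serves the non-existence half, where a global solution is given.

    No comparison principle is used: the discounted solution is singled out by maximality among
    subsolutions above [v], not by uniqueness. The functions u_lam may blow up as lam -> 0; only lam
    (u_lam - v) and the local oscillations stay bounded. Now lam (u_lam - v)(z) is its value at [x0]
    plus lam times a locally bounded difference, which disappears in the limit: this is why the
    limit level c - b is the same at all points of [M].

    Supersolutions inherit stability from subsolutions through u -> -u and H(x, p) -> -H(x, -p). *)

Lemma is_diff_near_eq (R : realType) (V W : normedModType R) (f h df : V -> W)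
    (y : V) :
  (\forall z \near y, f z = h z) -> is_diff y f df -> is_diff y h df.
Proof.
move=> fh [/diff_locallyP [cf ef] <-].
have cvf : continuous ('d f y) by exact: cf.
have eh : h \o shift y = cst (h y) + 'd f y +o_ 0 id.
  apply/eqaddoP => e e0.
  move/eqaddoP: ef => /(_ e e0) ef.
  have nh : \forall z \near (0 : V), f (z + y) = h (z + y).
    have := fh; rewrite (near_shift 0) /=.
    by apply: filterS => z /=; rewrite subr0.
  near=> z.
  have -> : (h \o shift y - (cst (h y) + 'd f y)) z =
     (f \o shift y - (cst (f y) + 'd f y)) z.
    rewrite !fctE /= -(near nh z)//; congr (_ - (_ + _)).
    by rewrite (nbhs_singleton fh).
  by near: z.
have dh := diff_unique cvf eh.
split; last by [].
apply/diff_locallyP; rewrite dh; split => //.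
Unshelve. all: by end_near. Qed.

(** Relational form of the gradient: it carries differentiability along with the value, so that the
    rules of calculus chain without side conditions. *)
Definition isgrad (R : realType) (n : nat) (f : 'rV[R]_n -> R) (y : 'rV[R]_n)
    (q : 'cV[R]_n) :=
  is_diff y f (fun v => (v *m q) 0 0).

Definition grad (R : realType) (n : nat) (f : 'rV[R]_n -> R) (y : 'rV[R]_n) :
    'cV[R]_n :=
  \col_i 'd f y (delta_mx 0 i).

Lemma isgrad_eq (R : realType) n (f df : 'rV[R]_n -> R) y q :
  is_diff y f df -> (forall v, df v = (v *m q) 0 0) -> isgrad f y q.
Proof. by move=> fd /funext e; rewrite /isgrad -e. Qed.

Lemma dfunE (R : realType) n (M : topologicalType) (A : smooth_atlas R n M)
    (phi : M -> R) x :
  dfun A phi x = grad (phi \o cinv (chart_at A x)) (cmap (chart_at A x) x).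
Proof. by apply/matrixP => i j; rewrite !mxE. Qed.

Section Gradient.
Context {R : realType} {n : nat}.
Implicit Types (f h : 'rV[R]_n -> R) (y z : 'rV[R]_n) (q : 'cV[R]_n).

Lemma isgrad_grad f y : differentiable f y -> isgrad f y (grad f y).
Proof.
move=> df; split => //; apply/funext => v.
rewrite {1}(row_sum_delta v) linear_sum mxE; apply: eq_bigr => i _.
by rewrite linearZ /= mxE.
Qed.

Lemma gradE f y i j : differentiable f y ->
  grad f y i j = 'D_(delta_mx 0 i) f y.
Proof. by move=> df; rewrite mxE deriveE. Qed.

Lemma isgradE f y q : isgrad f y q -> grad f y = q.
Proof.
move=> [_ e]; apply/matrixP => i j; rewrite !mxE e -rowE mxE.
by congr (q _ _); rewrite ord1.
Qed.

Lemma isgrad_near f h y q :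
  (\forall z \near y, f z = h z) -> isgrad f y q -> isgrad h y q.
Proof. exact: is_diff_near_eq. Qed.

Lemma near_grad f h y : differentiable f y ->
  (\forall z \near y, f z = h z) -> grad f y = grad h y.
Proof.
move=> df fh; apply/esym/isgradE/(isgrad_near fh); exact: isgrad_grad.
Qed.

Lemma isgrad_cst (a : R) y : isgrad (cst a) y 0.
Proof. by apply: (isgrad_eq (is_diff_cst a y)) => v; rewrite mulmx0 mxE. Qed.

Lemma isgradD f h y p q : isgrad f y p -> isgrad h y q ->
  isgrad (fun z => f z + h z) y (p + q).
Proof.
by move=> fp hq; apply: (isgrad_eq (is_diffD fp hq)) => v; rewrite mulmxDr mxE.
Qed.

Lemma isgradM f h y p q : isgrad f y p -> isgrad h y q ->
  isgrad (fun z => f z * h z) y (f y *: q + h y *: p).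
Proof.
move=> fp hq; apply: (isgrad_eq (is_diffM fp hq)) => v.
by rewrite mulmxDr [RHS]mxE -!scalemxAr; congr (_ + _); rewrite [RHS]mxE.
Qed.

Lemma isgradN f y p : isgrad f y p -> isgrad (fun z => - f z) y (- p).
Proof.
by move=> fp; apply: (isgrad_eq (is_diffN fp)) => v; rewrite mulmxN mxE.
Qed.

Lemma isgrad_comp1 (k : R -> R) (k' : R) f y p :
  isgrad f y p -> is_derive (f y) 1 k k' ->
  isgrad (k \o f) y (k' *: p).
Proof.
move=> fp [/derivable1_diffP dk ek].
have kd : is_diff (f y) k (fun t => k' * t).
  split => //; rewrite diff1E //; apply/funext => t.
  by rewrite derive1E ek /GRing.scale /= mulrC.
apply: (isgrad_eq (is_diff_comp fp kd)) => v.
by rewrite /= -scalemxAr [RHS]mxE.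
Qed.

Lemma isgrad_comp m (F : 'rV[R]_m -> 'rV[R]_n) (y : 'rV[R]_m) f p :
  differentiable F y -> isgrad f (F y) p ->
  isgrad (f \o F) y ('J F y *m p).
Proof.
move=> dF fp.
apply: (isgrad_eq (is_diff_comp (differentiableP dF) fp)) => v.
by rewrite /= mulmxA /jacobian mul_rV_lin1.
Qed.

Definition sqn z : R := (z *m z^T) 0 0.

Lemma sqnE z : sqn z = \sum_i z 0 i ^+ 2.
Proof. by rewrite /sqn mxE; apply: eq_bigr => i _; rewrite mxE expr2. Qed.

Lemma isgrad_coord i y : isgrad (fun z => z 0 i) y (delta_mx i 0).
Proof.
have -> : (fun z => z 0 i) = (fun z => (z *m (delta_mx i 0 : 'cV[R]_n)) 0 0).
  by apply/funext => z; rewrite -colE mxE.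
have hl : linear (fun z => (z *m (delta_mx i 0 : 'cV[R]_n)) 0 0).
  by move=> a u v; rewrite mulmxDl -scalemxAl !mxE.
pose L := GRing.isLinear.Build R _ _ _ _ hl.
pose Lf : {linear 'rV[R]_n -> R} := HB.pack (fun z : 'rV[R]_n => (z *m (delta_mx i 0 : 'cV[R]_n)) 0 0) L.
have cL : continuous Lf.
  move=> z; rewrite /Lf /=.
  have -> : (fun z0 : 'rV[R]_n => (z0 *m (delta_mx i 0 : 'cV[R]_n)) 0 0) = (fun z0 => z0 0 i).
    by apply/funext => z0; rewrite -colE mxE.
  exact: coord_continuous.
apply: (@DiffDef _ _ _ (nbhs_filter_on y) (Phantom _ (nbhs y)) Lf).
  exact: linear_differentiable.
exact: diff_lin.
Qed.

Lemma isgrad_sum (I : Type) (r : seq I) (F : I -> 'rV[R]_n -> R) G y :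
  (forall i, isgrad (F i) y (G i)) ->
  isgrad (fun z => \sum_(i <- r) F i z) y (\sum_(i <- r) G i).
Proof.
move=> FG; elim: r => [|i r IH].
  rewrite big_nil (_ : (fun _ => _) = cst 0); first exact: isgrad_cst.
  by apply/funext => z; rewrite big_nil.
rewrite big_cons (_ : (fun _ => _) = (fun z => F i z + \sum_(j <- r) F j z)).
  exact: isgradD.
by apply/funext => z; rewrite big_cons.
Qed.

Lemma isgrad_sqn z0 y : isgrad (fun z => sqn (z - z0)) y (2 *: (y - z0)^T).
Proof.
have -> : (fun z => sqn (z - z0)) =
  (fun z => \sum_i ((z 0 i + (- z0 0 i)) * (z 0 i + (- z0 0 i)))).
  by apply/funext => z; rewrite sqnE; apply: eq_bigr => i _; rewrite !mxE expr2.
have -> : 2 *: (y - z0)^T = \sum_i ((y 0 i - z0 0 i) *: (delta_mx i 0 + 0) +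
   (y 0 i - z0 0 i) *: (delta_mx i 0 + 0)) :> 'cV[R]_n.
  rewrite {1}(row_sum_delta (y - z0)) linear_sum /= scaler_sumr.
  by apply: eq_bigr => i _; rewrite linearZ /= trmx_delta addr0 !mxE -scalerDl scalerA mulrDl !mul1r.
apply: isgrad_sum => i; apply: isgradM; apply: isgradD;
  [exact: isgrad_coord|exact: isgrad_cst|exact: isgrad_coord|exact: isgrad_cst].
Qed.

End Gradient.

(* Without this, failed unifications unfold differentials and diverge. *)
Opaque diff derive jacobian grad.

Lemma cvg_mx_coord (R : realType) (m n : nat) (T : Type) (F : set_system T)
    {FF : Filter F} (G : T -> 'M[R]_(m, n)) (l : 'M[R]_(m, n)) :
  (forall i j, G t i j @[t --> F] --> l i j) -> G t @[t --> F] --> l.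
Proof.
move=> Gl; apply/cvgrPdist_le => /= e e0; near=> t.
rewrite /Num.Def.normr/= mx_normrE (bigmax_le _ (ltW e0))//= => -[i j] _.
rewrite !mxE /=; move: i j; near: t.
apply: filter_forall => i; apply: filter_forall => j.
exact: ((cvgrPdist_le _ _).1 (Gl i j)).
Unshelve. all: by end_near. Qed.

Lemma cvg_mulmx (R : realType) (m n p : nat) (T : Type) (F : set_system T)
    {FF : Filter F} (G : T -> 'M[R]_(m, n)) (H : T -> 'M[R]_(n, p)) (l : 'M[R]_(m, n))
    (k : 'M[R]_(n, p)) :
  G t @[t --> F] --> l -> H t @[t --> F] --> k ->
  (G t *m H t) @[t --> F] --> l *m k.
Proof.
move=> Gl Hk; apply: cvg_mx_coord => i j.
rewrite (_ : (fun t => _) = (fun t => \sum_r G t i r * H t r j)); last first.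
  by apply/funext => t; rewrite mxE.
rewrite mxE; apply: cvg_big => [|r _]; first exact: add_continuous.
apply: cvgM.
  exact: (cvg_comp _ (fun A : 'M[R]_(m, n) => A i r) Gl (@coord_continuous _ _ _ i r l)).
exact: (cvg_comp _ (fun A : 'M[R]_(n, p) => A r j) Hk (@coord_continuous _ _ _ r j k)).
Qed.

Lemma cvg_trmx (R : realType) (m n : nat) (T : Type) (F : set_system T)
    {FF : Filter F} (G : T -> 'M[R]_(m, n)) (l : 'M[R]_(m, n)) :
  G t @[t --> F] --> l -> (G t)^T @[t --> F] --> l^T.
Proof.
move=> Gl; apply: cvg_mx_coord => i j; rewrite mxE.
rewrite (_ : (fun t => _) = (fun t => G t j i)).
  exact: (cvg_comp _ (fun A : 'M[R]_(m, n) => A j i) Gl (@coord_continuous _ _ _ j i l)).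
by apply/funext => t; rewrite mxE.
Qed.

Lemma near_eq_continuous (T U : topologicalType) (f h : T -> U) (x : T) :
  (\forall z \near x, f z = h z) -> {for x, continuous f} ->
  {for x, continuous h}.
Proof.
move=> fh cf; rewrite /prop_for /continuous_at -(nbhs_singleton fh).
by apply: cvg_trans cf; apply: near_eq_cvg.
Qed.

Lemma cV_le_eq (R : realType) (n : nat) (p q : 'cV[R]_n) :
  (forall v : 'rV[R]_n, (v *m p) 0 0 <= (v *m q) 0 0) -> p = q.
Proof.
move=> pq; apply/colP => i.
have ec (r : 'cV[R]_n) : ((delta_mx 0 i : 'rV[R]_n) *m r) 0 0 = r i 0.
  by rewrite -rowE mxE.
have := pq (delta_mx 0 i); rewrite ec ec => h1.
have := pq (- delta_mx 0 i).
rewrite !mulNmx.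
have eN (a : 'M[R]_1) : (- a) 0 0 = - (a 0 0) by rewrite mxE.
rewrite eN eN ec ec lerN2 => h2.
by apply: le_anti; rewrite h1 h2.
Qed.

Section C1.
Context {R : realType} {n : nat}.
Implicit Types (f h : 'rV[R]_n -> R) (y z : 'rV[R]_n) (q : 'cV[R]_n).

(* The condition is imposed near [y], so that it is an open condition. *)
Definition C1 f y :=
  \forall z \near y, differentiable f z /\ {for z, continuous (grad f)}.

Lemma C1_differentiable f y : C1 f y -> differentiable f y.
Proof. by move/nbhs_singleton => []. Qed.

Lemma C1_isgrad f y : C1 f y -> isgrad f y (grad f y).
Proof. by move/C1_differentiable/isgrad_grad. Qed.

Lemma C1_continuous f y : C1 f y -> {for y, continuous f}.
Proof. by move/C1_differentiable/differentiable_continuous. Qed.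

Lemma C1_grad_continuous f y : C1 f y -> {for y, continuous (grad f)}.
Proof. by move/nbhs_singleton => []. Qed.

Lemma C1_near f y : C1 f y -> \forall z \near y, C1 f z.
Proof. exact: near_join. Qed.

Lemma C1_of_grad f (G : 'rV[R]_n -> 'cV[R]_n) y :
  (\forall z \near y, isgrad f z (G z) /\ {for z, continuous G}) -> C1 f y.
Proof.
move=> fG; have := near_join fG; apply: filterS => z nz; split.
  by have [[]] := nbhs_singleton nz.
have [_] := nbhs_singleton nz; apply: near_eq_continuous.
by apply: filterS nz => t [/isgradE].
Qed.

Lemma C1_eq f h y : (\forall z \near y, f z = h z) -> C1 f y -> C1 h y.
Proof.
move=> fh cf; apply: (@C1_of_grad _ (grad f)).
have := near_join fh; move: cf; apply: filterS2 => z [df cgf] nz; split => //.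
by apply: (isgrad_near nz); exact: isgrad_grad.
Qed.

Lemma C1_cst (a : R) y : C1 (cst a) y.
Proof.
apply: (@C1_of_grad _ (cst 0)); near=> z; split; first exact: isgrad_cst.
exact: cst_continuous.
Unshelve. all: by end_near. Qed.

Lemma C1D f h y : C1 f y -> C1 h y -> C1 (fun z => f z + h z) y.
Proof.
move=> cf ch; apply: (@C1_of_grad _ (fun z => grad f z + grad h z)).
move: cf ch; apply: filterS2 => z [df cf] [dh ch]; split.
  by apply: isgradD; exact: isgrad_grad.
exact: (cvgD cf ch).
Qed.

Lemma C1N f y : C1 f y -> C1 (fun z => - f z) y.
Proof.
move=> cf; apply: (@C1_of_grad _ (fun z => - grad f z)).
move: cf; apply: filterS => z [df cf]; split.
  by apply: isgradN; exact: isgrad_grad.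
exact: (cvgN cf).
Qed.

Lemma C1M f h y : C1 f y -> C1 h y -> C1 (fun z => f z * h z) y.
Proof.
move=> cf ch; apply: (@C1_of_grad _ (fun z => f z *: grad h z + h z *: grad f z)).
move: cf ch; apply: filterS2 => z [df cf] [dh ch]; split.
  by apply: isgradM; exact: isgrad_grad.
have fc := differentiable_continuous df.
have hc := differentiable_continuous dh.
exact: (cvgD (cvgZ fc ch) (cvgZ hc cf)).
Qed.

Lemma C1_comp1 (k k' : R -> R) f y :
  (\forall t \near f y, is_derive (t : R) 1 k (k' t) /\ {for t, continuous k'}) ->
  C1 f y -> C1 (k \o f) y.
Proof.
move=> dk cf; apply: (@C1_of_grad _ (fun z => k' (f z) *: grad f z)).
have := C1_continuous cf dk; move: cf; apply: filterS2 => z [df cf] [dkz ck].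
split; first by apply: isgrad_comp1 => //; exact: isgrad_grad.
have fc := differentiable_continuous df.
have kc : {for z, continuous (k' \o f)} by exact: continuous_comp.
exact: (cvgZ kc cf).
Qed.

Lemma C1_sqn z0 y : C1 (fun z => sqn (z - z0)) y.
Proof.
apply: (@C1_of_grad _ (fun z => 2 *: (z - z0)^T)); near=> z; split.
  exact: isgrad_sqn.
have c : (fun z' : 'rV[R]_n => z' - z0) @ z --> z - z0.
  exact: (cvgB cvg_id (cvg_cst _)).
have c2 : (fun z' : 'rV[R]_n => (z' - z0)^T) @ z --> (z - z0)^T.
  exact: (@cvg_trmx R 1 n 'rV[R]_n (nbhs z) _ (fun z' => z' - z0) (z - z0) c).
exact: (cvgZl_tmp (k := 2) c2).
Unshelve. all: by end_near. Qed.

(** The difference [h - f] has a local minimum at [y], so its one-sided quotients are non-negative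
    in every direction [v]; using both [v] and [-v] ([cV_le_eq]) gives equality. *)
Lemma grad_local_min f h y : differentiable f y -> differentiable h y ->
  f y = h y -> (\forall z \near y, f z <= h z) -> grad f y = grad h y.
Proof.
move=> df dh fhy fh.
have [_ ef] := isgrad_grad df; have [_ eh] := isgrad_grad dh.
apply: cV_le_eq => v.
rewrite -[leLHS]/((fun v => (v *m grad f y) 0 0) v) -ef.
rewrite -[leRHS]/((fun v => (v *m grad h y) 0 0) v) -eh.
rewrite leNgt; apply/negP; rewrite -subr_lt0 => lt0.
have dfh : differentiable (h - f) y by exact: differentiableB.
have := @diff_derivable _ _ _ (h - f) y v dfh .
rewrite /derivable => _.
have cq : (fun t : R => t^-1 *: ((h - f) (t *: v + y) - (h - f) y)) @ 0^' -->
    'd (h - f) y v.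
  by rewrite -deriveE//; exact: (@diff_derivable _ _ _ (h - f) y v dfh).
have {}cq := cvg_dnbhs_at_right cq.
have /(cvgr_lt _ cq) nq : 'd (h - f) y v < 0 by rewrite diffB//.
have nv : \forall t \near (0 : R), f (t *: v + y) <= h (t *: v + y).
  have cv : t *: v + y @[t --> (0 : R)] --> y.
    rewrite -[X in _ --> X]add0r -(scale0r v).
    by apply: cvgD; [apply: cvgZr_tmp; exact: cvg_id|exact: cvg_cst].
  exact: (cv _ fh).
have : \forall t \near (0 : R)^'+, False.
  near=> t.
  have t0 : 0 < t by near: t; exact: nbhs_right_gt.
  have : t^-1 *: ((h - f) (t *: v + y) - (h - f) y) < 0.
    by near: t; exact: nq.
  rewrite ltNge => /negP; apply.
  rewrite !fctE fhy subrr subr0 mulr_ge0// ?invr_ge0 ?(ltW t0)//. rewrite subr_ge0.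
  by near: t; exact: (cvg_within _ nv).
by move/filter_ex => [].
Unshelve. all: by end_near. Qed.

End C1.

Definition C1map (R : realType) (m n : nat) (F : 'rV[R]_m -> 'rV[R]_n)
    (y : 'rV[R]_m) :=
  \forall z \near y, differentiable F z /\
    (forall v, {for z, continuous ('D_v F)}).

Lemma jacobian_continuous (R : realType) (m n : nat)
    (F : 'rV[R]_m -> 'rV[R]_n) y :
  C1map F y -> {for y, continuous (jacobian F)}.
Proof.
move=> cF; rewrite /prop_for /continuous_at.
apply: (@cvg_mx_coord R m n _ (nbhs y)) => i j.
have e z : differentiable F z -> jacobian F z i j = 'D_(delta_mx 0 i) F z 0 j.
  by move=> dF; rewrite deriveE// mxE.
have [dFy _] := nbhs_singleton cF.
apply: (eq_ind_r (fun a : R => (fun t => jacobian F t i j) @ nbhs y --> nbhs a) _ (e y dFy)).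
have [_ /(_ (delta_mx 0 i)) c] := nbhs_singleton cF.
have := cvg_comp _ (fun A : 'rV[R]_n => A 0 j) c (@coord_continuous _ _ _ 0 j _).
apply: cvg_trans; apply: near_eq_cvg.
by apply: filterS cF => z [/e ->].
Qed.

Lemma C1_comp (R : realType) (m n : nat) (F : 'rV[R]_m -> 'rV[R]_n)
    (f : 'rV[R]_n -> R) (y : 'rV[R]_m) :
  C1map F y -> C1 f (F y) -> C1 (f \o F) y.
Proof.
move=> cF cf; apply: (@C1_of_grad _ _ _ (fun z => jacobian F z *m grad f (F z))).
have dF : differentiable F y by have [] := nbhs_singleton cF.
have nf : \forall z \near y,
    differentiable f (F z) /\ {for F z, continuous (grad f)}.
  exact: (differentiable_continuous dF cf).
apply: filterS2 (near_join cF) nf => z nF [dfz cfz].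
have dFz : differentiable F z by have [] := nbhs_singleton nF.
split; first by apply: isgrad_comp => //; exact: isgrad_grad.
have c1 := jacobian_continuous nF.
have c2 : {for z, continuous (grad f \o F)}.
  by apply: continuous_comp => //; exact: differentiable_continuous.
exact: (cvg_mulmx c1 c2).
Qed.

(** Together with its converse below, this links the derivative-by-direction notion [Ck_on] of the
    statement to the pointwise [C1], which bundles the directional derivatives into one continuous
    gradient. *)
Lemma Ck_on1_C1 (R : realType) (n : nat) (f : 'rV[R]_n -> R) D :
  (forall y, D y -> C1 f y) -> Ck_on 1 (f : 'rV[R]_n -> R^o) D.
Proof.
move=> fD; split=> [y /fD/C1_differentiable//|v y /fD cf /=].
have e z : differentiable f z -> (v *m grad f z) 0 0 = 'D_v f z.
  by move=> df; rewrite deriveE//; have [_ ->] := isgrad_grad df.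
apply: (@near_eq_continuous _ _ (fun z => (v *m grad f z) 0 0)).
  by move: cf; apply: filterS => z [/e].
have c : (fun z : 'rV[R]_n => v *m grad f z) @ y --> v *m grad f y.
  exact: (cvg_mulmx (cvg_cst v) (C1_grad_continuous cf)).
exact: (cvg_comp _ (fun A : 'M[R]_1 => A 0 0) c (@coord_continuous _ _ _ 0 0 _)).
Qed.

Lemma C1_Ck_on1 (R : realType) (n : nat) (f : 'rV[R]_n -> R) D y :
  nbhs y D -> Ck_on 1 (f : 'rV[R]_n -> R^o) D -> C1 f y.
Proof.
move=> nD [df cf]; have := near_join nD; apply: filterS => z /= nz.
have Dz := nbhs_singleton nz.
split; first exact: df.
apply: (@cvg_mx_coord R n 1 _ (nbhs z)) => i j.
apply: (eq_ind_r (fun a : R => (fun t => grad f t i j) @ nbhs z --> nbhs a) _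
  (gradE i j (df z Dz))).
apply: cvg_trans (cf (delta_mx 0 i) z Dz); apply: near_eq_cvg.
by apply: filterS nz => t Dt; rewrite gradE//; exact: df.
Qed.

Lemma C1map_smooth (R : realType) (m n : nat) (F : 'rV[R]_m -> 'rV[R]_n) D y :
  nbhs y D -> smooth_on F D -> C1map F y.
Proof.
move=> nD /(_ 1%N)[df cf].
by apply: filterS nD => z Dz; split => [|v]; [exact: df|exact: cf].
Qed.

(** * C^1 truncations, cones and cutoffs *)

Section PositivePartSquared.
Context {R : realType}.

(** The square of the positive part: its derivative also vanishes at 0, so it truncates while
    remaining C^1. *)
Definition possq (t : R) : R := Num.max t 0 ^+ 2.

Lemma possq_ge0 t : 0 <= possq t. Proof. exact: sqr_ge0. Qed.

Lemma possq_neg t : t <= 0 -> possq t = 0.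
Proof. by move=> t0; rewrite /possq max_r// expr0n. Qed.

Lemma possq_pos t : 0 <= t -> possq t = t ^+ 2.
Proof. by move=> t0; rewrite /possq max_l. Qed.

Lemma is_derive_possq (t : R) : is_derive t 1 possq (2 * Num.max t 0).
Proof.
have [t0|t0|->] := ltrgtP t 0.
- rewrite mulr0; apply: (@near_eq_is_derive _ _ _ (cst 0)).
    near=> s; rewrite possq_neg//; apply: ltW; near: s; exact: lt_nbhsl.
- apply: (@near_eq_is_derive _ _ _ (fun s : R => s * s)).
    near=> s; rewrite possq_pos ?expr2//; apply: ltW; near: s; exact: lt_nbhsr.
  have -> : 2 * t = t *: 1 + t *: 1 :> R by rewrite /GRing.scale /=; ring.
  exact: (is_deriveM (is_derive_id t 1) (is_derive_id t 1)).
- rewrite mulr0.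
  have c : (fun h : R => h^-1 *: (possq (h *: 1 + 0) - possq 0)) @ 0^' --> (0 : R).
    apply/cvgrPdist_lt => e e0; near=> h.
    rewrite [possq 0]possq_neg// subr0 addr0 [h *: 1]mulr1 sub0r normrN normrZ.
    have h0 : h != 0 by near: h; exact: nbhs_dnbhs_neq.
    have he : `|h| < e by near: h; exact: dnbhs0_lt.
    rewrite normfV ltr_pdivrMl ?normr_gt0//.
    have [hp|hn] := leP 0 h.
      by rewrite possq_pos// normrX expr2 ltr_pM2l ?normr_gt0.
    by rewrite possq_neg ?normr0 ?mulr_gt0 ?normr_gt0// ltW.
  split; last exact: cvg_lim c.
  by apply/cvg_ex; exists 0.
Unshelve. all: by end_near. Qed.

Lemma continuous_possq' (t : R) : {for t, continuous (fun s : R => 2 * Num.max s 0)}.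
Proof.
have c : (fun s : R => Num.max s 0) @ t --> Num.max t 0.
  exact: (@continuous_max R R id (cst 0) t (@cvg_id _ _) (@cvg_cst _ _ _ _ _)).
exact: (cvgM (cvg_cst _) c).
Qed.

End PositivePartSquared.

Section Radial.
Context {R : realType} {n : nat}.
Implicit Types (f h : 'rV[R]_n -> R) (y z : 'rV[R]_n) (q : 'cV[R]_n).

Lemma C1_possq f y : C1 f y -> C1 (fun z => possq (f z)) y.
Proof.
apply: (@C1_comp1 _ _ possq (fun t => 2 * Num.max t 0)).
apply: filterE => t; split; first exact: is_derive_possq.
exact: continuous_possq'.
Qed.

Lemma C1_sqrt f y : 0 < f y -> C1 f y -> C1 (fun z => Num.sqrt (f z)) y.
Proof.
move=> fy; apply: (@C1_comp1 _ _ Num.sqrt (fun t => (2 * Num.sqrt t)^-1)).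
near=> t; have t0 : 0 < t by near: t; exact: lt_nbhsr.
split; first exact: is_derive1_sqrt.
apply: cvgV; first by rewrite mulf_neq0// gt_eqF// sqrtr_gt0.
exact: (cvgM (cvg_cst _) (@sqrt_continuous R t)).
Unshelve. all: by end_near. Qed.

Lemma sqn_ge0 z : 0 <= sqn z.
Proof. by rewrite sqnE; apply: sumr_ge0 => i _; exact: sqr_ge0. Qed.

Lemma sqn0 : sqn (0 : 'rV[R]_n) = 0.
Proof. by rewrite /sqn mul0mx mxE. Qed.

Lemma sqnN z : sqn (- z) = sqn z.
Proof. by rewrite /sqn linearN /= mulmxN mulNmx opprK. Qed.

Lemma sqr_coord_le_sqn z i : z 0 i ^+ 2 <= sqn z.
Proof.
rewrite sqnE (bigD1 i)//= lerDl; apply: sumr_ge0 => j _; exact: sqr_ge0.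
Qed.

Lemma sqn_eq0 z : sqn z = 0 -> z = 0.
Proof.
move=> z0; apply/rowP => i; rewrite mxE; apply/eqP.
by rewrite -sqrf_eq0 eq_le sqr_ge0 andbT -z0 sqr_coord_le_sqn.
Qed.

Lemma norm_le_sqn z r : 0 <= r -> sqn z <= r ^+ 2 -> `|z| <= r.
Proof.
move=> r0 zr; rewrite /Num.Def.normr/= mx_normrE (bigmax_le _ r0)//= => -[i j] _.
rewrite -(@ler_pXn2r _ 2)//= ?nnegrE// -normrX ger0_norm ?sqr_ge0//.
by apply: le_trans zr; rewrite /= (ord1 i); exact: sqr_coord_le_sqn.
Qed.

Lemma sqn_continuous z0 : continuous (fun z => sqn (z - z0)).
Proof. by move=> z; exact: (C1_continuous (C1_sqn z0 z)). Qed.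

Lemma nbhs_sqn y (U : set 'rV[R]_n) : nbhs y U ->
  exists2 r, 0 < r & forall z, sqn (z - y) <= r ^+ 2 -> U z.
Proof.
move=> /nbhs_ballP[e /= e0 eU]; exists (e / 2); first by rewrite divr_gt0.
move=> z zy; apply: eU; rewrite -ball_normE /= -opprB normrN.
apply: le_lt_trans (norm_le_sqn _ zy) _; first by rewrite divr_ge0// ltW.
by rewrite ltr_pdivrMr// ltr_pMr// ltr1n.
Qed.

Lemma sqn_nbhs y r : 0 < r -> \forall z \near y, sqn (z - y) < r.
Proof.
move=> r0; apply: (cvgr_lt _ (@sqn_continuous y y)).
by rewrite subrr sqn0.
Qed.

Lemma sqn_ball_closed y r : closed [set z | sqn (z - y) <= r].
Proof.
have : closed ((fun z => sqn (z - y)) @^-1` [set t | t <= r]).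
  by apply: closed_comp; [move=> z _; exact: sqn_continuous|exact: closed_le].
by [].
Qed.

Lemma sqn_ball_compact y r : compact [set z | sqn (z - y) <= r].
Proof.
apply: bounded_closed_compact; last exact: sqn_ball_closed.
exists (`|y| + (`|r| + 1)); split; first by [].
move=> M Mr z /= zr; apply: ltW; apply: le_lt_trans Mr.
rewrite -(subrK y z) addrC; apply: le_trans (ler_normD _ _) _.
rewrite lerD2l norm_le_sqn// ?addr_ge0//; apply: le_trans zr _.
apply: le_trans (ler_norm _) _; rewrite sqrrD1.
have := normr_ge0 r; set a := `|r|; nra.
Qed.

(** The gradient is radial, and for non-negative [L] and [k] both coefficients are non-negative, so
    the truncated term never lowers the slope below [L]. *)
Lemma isgrad_cone (L k rho : R) z y : z != y ->
  isgrad (fun x => L * Num.sqrt (sqn (x - z)) + k * possq (sqn (x - z) - rho)) y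
    ((L / Num.sqrt (sqn (y - z)) + 4 * k * Num.max (sqn (y - z) - rho) 0) *:
       (y - z)^T).
Proof.
move=> zy.
have sp : 0 < sqn (y - z).
  rewrite lt_neqAle sqn_ge0 andbT eq_sym; apply/eqP => /sqn_eq0/eqP.
  by rewrite subr_eq0 eq_sym (negbTE zy).
have g1 := isgrad_comp1 (isgrad_sqn z y) (is_derive1_sqrt sp).
have g2 := isgrad_comp1 (isgradD (isgrad_sqn z y) (isgrad_cst (- rho) y)) (is_derive_possq _).
have := isgradD (isgradM (isgrad_cst L y) g1) (isgradM (isgrad_cst k y) g2).
rewrite /= !scaler0 !addr0 !scalerA -scalerDl.
set a := (X in isgrad _ _ (X *: _)); set b := (X in _ -> isgrad _ _ (X *: _)).
suff -> : a = b by [].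
rewrite /a /b; field.
by rewrite gt_eqF// sqrtr_gt0.
Qed.

Lemma C1_cone (L k rho : R) z y : z != y ->
  C1 (fun x => L * Num.sqrt (sqn (x - z)) + k * possq (sqn (x - z) - rho)) y.
Proof.
move=> zy.
have sp : 0 < sqn (y - z).
  rewrite lt_neqAle sqn_ge0 andbT eq_sym; apply/eqP => /sqn_eq0/eqP.
  by rewrite subr_eq0 eq_sym (negbTE zy).
apply: C1D; apply: C1M; try exact: C1_cst.
  by apply: C1_sqrt => //; exact: C1_sqn.
by apply: C1_possq; apply: C1D; [exact: C1_sqn|exact: C1_cst].
Qed.

(** A C^1 cutoff in s = |z - y|^2 / r. For s <= 1 the inner square is at least 1, so the outer
    positive part vanishes and the value is 1; for s >= 2 the inner square is 0 and the value is 0.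
    Note that [r] is a squared radius. *)
Definition plateau (y : 'rV[R]_n) (r : R) (z : 'rV[R]_n) : R :=
  1 - possq (1 - possq (2 - r^-1 * sqn (z - y))).

Lemma C1_plateau y r z : C1 (plateau y r) z.
Proof.
apply: C1D; first exact: C1_cst.
apply: C1N; apply: C1_possq; apply: C1D; first exact: C1_cst.
apply: C1N; apply: C1_possq; apply: C1D; first exact: C1_cst.
by apply: C1N; apply: C1M; [exact: C1_cst|exact: C1_sqn].
Qed.

Lemma plateau_itv y r z : 0 <= plateau y r z <= 1.
Proof.
rewrite /plateau; have := possq_ge0 (2 - r^-1 * sqn (z - y)); set a := possq _ => a0.
rewrite subr_ge0 lerBlDr lerDl possq_ge0 andbT.
have [h|h] := leP 0 (1 - a); last by rewrite possq_neg// ltW.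
rewrite possq_pos//; nra.
Qed.

Lemma plateau_in y r z : 0 < r -> sqn (z - y) <= r -> plateau y r z = 1.
Proof.
move=> r0 zr; have h : r^-1 * sqn (z - y) <= 1 by rewrite ler_pdivrMl// mulr1.
rewrite /plateau (possq_pos (t := 2 - _)); last lra.
by rewrite possq_neg ?subr0// subr_le0; nra.
Qed.

Lemma plateau_out y r z : 0 < r -> 2 * r <= sqn (z - y) -> plateau y r z = 0.
Proof.
move=> r0 zr; have h : 2 <= r^-1 * sqn (z - y) by rewrite ler_pdivlMl// mulrC.
by rewrite /plateau (@possq_neg _ (2 - _)) ?subr0 ?possq_pos ?expr1n ?subrr// subr_le0.
Qed.

End Radial.

(** * C^1 functions on the manifold *)

Section Charts.
Context {R : realType} {n : nat} {M : topologicalType}.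
Implicit Types (c d : chart R n M) (x : M).

Lemma nbhs_cinv c x (P : set M) : cdom c x ->
  (\forall z \near x, P z) -> \forall y \near cmap c x, P (cinv c y).
Proof.
move=> cx nP; have cy : (cmap c @` cdom c) (cmap c x) by exists x.
by have := @cinv_continuous _ _ _ c _ cy P; rewrite cmapK//; apply.
Qed.

Lemma nbhs_cmap c x (P : set 'rV[R]_n) : cdom c x ->
  (\forall y \near cmap c x, P y) -> \forall z \near x, P (cmap c z).
Proof. by move=> cx nP; exact: (cmap_continuous cx nP). Qed.

Lemma nbhs_cdom c x : cdom c x -> \forall z \near x, cdom c z.
Proof. by move=> cx; apply: open_nbhs_nbhs; split => //; exact: cdom_open. Qed.

Lemma nbhs_cimg c x : cdom c x -> \forall y \near cmap c x,
  cdom c (cinv c y) /\ cmap c (cinv c y) = y.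
Proof.
move=> cx; have : \forall y \near cmap c x, (cmap c @` cdom c) y.
  by apply: open_nbhs_nbhs; split; [exact: cimg_open|exists x].
by apply: filterS => _ [z cz <-]; rewrite cmapK.
Qed.

End Charts.

Section C1Manifold.
Context {R : realType} {n : nat} {M : topologicalType}.
Variable A : smooth_atlas R n M.
Implicit Types (c d : chart R n M) (x : M) (phi psi : M -> R).

Lemma chart_atP x : charts A (chart_at A x) /\ cdom (chart_at A x) x.
Proof. by rewrite /chart_at; case: cid. Qed.

Lemma C1map_transition c d x : charts A c -> charts A d -> cdom c x ->
  cdom d x -> C1map (cmap d \o cinv c) (cmap c x).
Proof.
move=> Ac Ad cx dx; apply: C1map_smooth (charts_smooth Ac Ad).
apply: filterS2 (nbhs_cimg cx) (nbhs_cinv cx (nbhs_cdom dx)) => y [cy ey] dy.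
by exists (cinv c y).
Qed.

Definition mC1 phi x :=
  forall c, charts A c -> cdom c x -> C1 (phi \o cinv c) (cmap c x).

Lemma comp_transition c d x phi : cdom c x -> cdom d x ->
  \forall y \near cmap d x,
    ((phi \o cinv c) \o (cmap c \o cinv d)) y = (phi \o cinv d) y.
Proof.
move=> cx dx; apply: filterS (nbhs_cinv dx (nbhs_cdom cx)) => y cy.
by rewrite /= cmapK.
Qed.

Lemma mC1_chart c x phi : charts A c -> cdom c x ->
  C1 (phi \o cinv c) (cmap c x) -> mC1 phi x.
Proof.
move=> Ac cx cphi d Ad dx; apply: C1_eq (comp_transition phi cx dx) _.
apply: C1_comp; first exact: C1map_transition.
by rewrite /= cmapK.
Qed.

(** [dfun] is computed in the chart [chart_at A x]; the chain rule through the transition map to [c]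
    produces the factor [dchart A c x]. This permits work in one fixed chart around a point. *)
Lemma dfun_chart c x phi : charts A c -> cdom c x ->
  differentiable (phi \o cinv c) (cmap c x) ->
  dfun A phi x = dchart A c x *m grad (phi \o cinv c) (cmap c x).
Proof.
move=> Ac cx dphi; have [Ad dx] := chart_atP x.
rewrite dfunE; set d := chart_at A x in Ad dx *.
apply: isgradE; apply: isgrad_near (comp_transition phi cx dx) _.
rewrite /dchart -/d.
have [dF _] := nbhs_singleton (C1map_transition Ad Ac dx cx).
by apply: (isgrad_comp dF); rewrite /= (cmapK dx); exact: isgrad_grad.
Qed.

Lemma mC1_near phi x : mC1 phi x -> \forall z \near x, mC1 phi z.
Proof.
have [Ac cx] := chart_atP x; move=> /(_ _ Ac cx)/C1_near/(nbhs_cmap cx).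
by apply: filterS2 (nbhs_cdom cx) => z cz; exact: mC1_chart.
Qed.

Lemma mC1_eq phi psi x : (\forall z \near x, phi z = psi z) ->
  mC1 phi x -> mC1 psi x.
Proof.
move=> e cphi c Ac cx; apply: C1_eq (cphi c Ac cx).
exact: (nbhs_cinv cx e).
Qed.

Lemma mC1_cst (a : R) x : mC1 (cst a) x.
Proof. by move=> c _ _; exact: C1_cst. Qed.

Lemma mC1D phi psi x : mC1 phi x -> mC1 psi x -> mC1 (fun z => phi z + psi z) x.
Proof. by move=> h k c Ac cx; exact: (C1D (h c Ac cx) (k c Ac cx)). Qed.

Lemma mC1M phi psi x : mC1 phi x -> mC1 psi x -> mC1 (fun z => phi z * psi z) x.
Proof. by move=> h k c Ac cx; exact: (C1M (h c Ac cx) (k c Ac cx)). Qed.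

Lemma mC1N phi x : mC1 phi x -> mC1 (fun z => - phi z) x.
Proof. by move=> h c Ac cx; exact: (C1N (h c Ac cx)). Qed.

Lemma mC1_continuous phi x : mC1 phi x -> {for x, continuous phi}.
Proof.
have [Ac cx] := chart_atP x; move=> /(_ _ Ac cx)/C1_continuous cphi.
apply: (@near_eq_continuous _ _ (phi \o cinv (chart_at A x) \o cmap (chart_at A x))).
  by apply: filterS (nbhs_cdom cx) => z cz /=; rewrite cmapK.
by apply: continuous_comp => //; exact: cmap_continuous.
Qed.

Lemma comp_chartK c x (f : 'rV[R]_n -> R) : cdom c x ->
  \forall y \near cmap c x, f y = ((f \o cmap c) \o cinv c) y.
Proof. by move=> cx; apply: filterS (nbhs_cimg cx) => y [_ /= ->]. Qed.

Lemma mC1_pull c x f : charts A c -> cdom c x -> C1 f (cmap c x) ->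
  mC1 (f \o cmap c) x.
Proof.
move=> Ac cx cf; apply: (mC1_chart Ac cx); exact: C1_eq (comp_chartK f cx) cf.
Qed.

Lemma dfun_pull c x f : charts A c -> cdom c x -> C1 f (cmap c x) ->
  dfun A (f \o cmap c) x = dchart A c x *m grad f (cmap c x).
Proof.
move=> Ac cx cf; have e := comp_chartK f cx.
have cf' := C1_differentiable (C1_eq e cf).
rewrite (dfun_chart Ac cx cf'); congr (_ *m _); apply/esym.
by apply: near_grad e; exact: C1_differentiable.
Qed.

Lemma mC1_grad phi x :
  mC1 phi x -> isgrad (phi \o cinv (chart_at A x)) (cmap (chart_at A x) x)
                 (dfun A phi x).
Proof.
have [Ac cx] := chart_atP x; move=> /(_ _ Ac cx) cphi.
by rewrite dfunE; exact: C1_isgrad.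
Qed.

Lemma dfunD phi psi x : mC1 phi x -> mC1 psi x ->
  dfun A (fun z => phi z + psi z) x = dfun A phi x + dfun A psi x.
Proof.
by move=> /mC1_grad h /mC1_grad k; rewrite dfunE; exact: (isgradE (isgradD h k)).
Qed.

Lemma dfunN phi x : mC1 phi x ->
  dfun A (fun z => - phi z) x = - dfun A phi x.
Proof. by move=> /mC1_grad h; rewrite dfunE; exact: (isgradE (isgradN h)). Qed.

Lemma dfun_cst (a : R) x : dfun A (cst a) x = 0.
Proof. by rewrite dfunE; exact: (isgradE (isgrad_cst a _)). Qed.

(** Touching functions have equal differentials. This is what allows one test function to be
    replaced by another throughout. *)
Lemma dfun_le phi psi x : mC1 phi x -> mC1 psi x -> phi x = psi x ->
  (\forall z \near x, phi z <= psi z) -> dfun A phi x = dfun A psi x.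
Proof.
have [Ac cx] := chart_atP x.
move=> /(_ _ Ac cx) cphi /(_ _ Ac cx) cpsi e le.
rewrite !dfunE; apply: grad_local_min; try exact: C1_differentiable.
  by rewrite /= cmapK.
exact: (nbhs_cinv cx le).
Qed.

Lemma dfun_eq phi psi x : mC1 phi x -> (\forall z \near x, phi z = psi z) ->
  dfun A phi x = dfun A psi x.
Proof.
move=> cphi e; apply: (dfun_le cphi (mC1_eq e cphi) (nbhs_singleton e)).
by apply: filterS e => z ->.
Qed.

Lemma C1_functionP phi : C1_function A phi <-> forall x, mC1 phi x.
Proof.
split=> [h x c Ac cx|h c Ac].
  apply: C1_Ck_on1 (h c Ac).
  by apply: filterS (nbhs_cimg cx) => y [cy ey]; exists (cinv c y).
by apply: Ck_on1_C1 => _ [x cx <-]; exact: h.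
Qed.

Section SmoothMaps.
Variable f : M -> M.
Hypothesis smf : smooth_map A f.

Lemma C1map_smooth_map c d x : charts A c -> charts A d -> cdom c x ->
  cdom d (f x) -> C1map (cmap d \o f \o cinv c) (cmap c x).
Proof.
move=> Ac Ad cx dx; apply: C1map_smooth (smf.2 c d Ac Ad).
have nf : \forall z \near x, cdom d (f z) by exact: (smf.1 x _ (nbhs_cdom dx)).
apply: filterS2 (nbhs_cimg cx) (nbhs_cinv cx nf) => y [cy ey] dy.
by exists (cinv c y).
Qed.

Lemma comp_smooth_map c d x phi : cdom c x -> cdom d (f x) ->
  \forall y \near cmap c x,
    ((phi \o cinv d) \o (cmap d \o f \o cinv c)) y = ((phi \o f) \o cinv c) y.
Proof.
move=> cx dx.
have nf : \forall z \near x, cdom d (f z) by exact: (smf.1 x _ (nbhs_cdom dx)).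
by apply: filterS (nbhs_cinv cx nf) => y dy; rewrite /= cmapK.
Qed.

Lemma mC1_comp phi x : mC1 phi (f x) -> mC1 (phi \o f) x.
Proof.
have [Ad dx] := chart_atP (f x); move=> /(_ _ Ad dx) cphi c Ac cx.
apply: C1_eq (comp_smooth_map phi cx dx) _; apply: C1_comp.
  exact: C1map_smooth_map.
by rewrite /= cmapK.
Qed.

Lemma dfun_comp phi x : mC1 phi (f x) ->
  dfun A (phi \o f) x = pullback (dfun A phi (f x)).
Proof.
have [Ad dx] := chart_atP (f x); have [Ac cx] := chart_atP x.
move=> /mC1_grad cphi; rewrite dfunE.
apply: isgradE; apply: isgrad_near (comp_smooth_map phi cx dx) _.
have [dF _] := nbhs_singleton (C1map_smooth_map Ac Ad cx dx).
by apply: (isgrad_comp dF); rewrite /= (cmapK cx).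
Qed.

End SmoothMaps.

End C1Manifold.

(** * Continuity and coercivity of the Hamiltonian in charts *)

Section Hamiltonian.
Context {R : realType} {n : nat} {M : topologicalType}.
Variable A : smooth_atlas R n M.
Implicit Types (c d : chart R n M) (x : M) (phi psi : M -> R) (H : hamiltonian A).

(** Cotangent vectors at [x] are columns read in [chart_at A x], a choice that may jump with [x].
    Continuity of [H] is therefore expressed along differentials of C^1 functions, where these jumps
    cancel. *)
Definition Hcont H := forall phi x, mC1 A phi x ->
  {for x, continuous (fun z => H z (dfun A phi z))}.

Lemma C2_Hcont H : C2_hamiltonian H -> Hcont H.
Proof.
move=> HC phi x cphi; have [Ac cx] := chart_atP A x.
set c := chart_at A x in Ac cx *.
pose F (yq : 'rV[R]_n * 'cV[R]_n) : R :=
  H (cinv c yq.1) (dchart A c (cinv c yq.1) *m yq.2).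
have cF y q : cimg c y -> {for (y, q), continuous F}.
  move=> cy; apply: (@differentiable_continuous _ _ _ (y, q) F).
  by have [+ _] := HC c Ac; apply; split.
pose G z := (cmap c z, grad (phi \o cinv c) (cmap c z)).
have cG : {for x, continuous G}.
  have gc : {for x, continuous (grad (phi \o cinv c) \o cmap c)}.
    exact: continuous_comp (cmap_continuous cx)
      (C1_grad_continuous (cphi c Ac cx)).
  exact: (cvg_pair (cmap_continuous cx) gc).
have cFG : {for x, continuous (F \o G)}.
  by apply: continuous_comp => //; apply: cF; exists x.
apply: near_eq_continuous cFG.
apply: filterS2 (nbhs_cdom cx) (mC1_near cphi) => z cz pz.
rewrite /F /G /= cmapK// -dfun_chart//.
exact: C1_differentiable (pz c Ac cz).
Qed.

Lemma Hcont_opp H : Hcont H -> Hcont (fun x p => - H x (- p)).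
Proof.
move=> HC phi x cphi.
have cN := HC _ _ (mC1N cphi).
have cN' : {for x, continuous (fun z => - H z (dfun A (fun t => - phi t) z))}.
  exact: cvgN cN.
apply: near_eq_continuous cN'.
by apply: filterS (mC1_near cphi) => z cz; rewrite dfunN.
Qed.

(** Sublevel sets of [H] are bounded in the coordinates of a fixed chart, uniformly near each point;
    this form needs no metric. *)
Definition Hcoercive H := forall (C : R) c x, charts A c -> cdom c x ->
  exists B : R, \forall z \near x, forall q : 'cV[R]_n,
    H z (dchart A c z *m q) <= C -> forall i, `|q i 0| <= B.

(** Ensures that the [sup] defining [dual_norm] is taken over a bounded set and is not a default
    value. Writing p = S w^T turns the pairing into the scalar product b(v, w), and positivity of b
    on v + w and v - w gives 2 |b(v, w)| <= b(v, v) + b(w, w). *)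
Lemma posdef_dual_bound (S : 'M[R]_n) (p : 'cV[R]_n) : S^T = S -> posdef S ->
  exists B : R, forall v : 'rV[R]_n, (v *m S *m v^T) 0 0 <= 1 ->
    `|(v *m p) 0 0| <= B.
Proof.
move=> symS posS.
have uS : S \in unitmx.
  rewrite -row_free_unit -kermx_eq0; apply/eqP/row_matrixP => i.
  apply/eqP; rewrite row0; apply/negPn/negP => /posS.
  by rewrite -row_mul mulmx_ker row0 mul0mx mxE ltxx.
pose w := (invmx S *m p)^T.
have -> : p = S *m w^T by rewrite trmxK mulKVmx.
have pos (v : 'rV[R]_n) : 0 <= (v *m S *m v^T) 0 0.
  have [->|v0] := eqVneq v 0; first by rewrite !mul0mx mxE.
  exact: ltW (posS _ v0).
exists (1 + (w *m S *m w^T) 0 0) => v v1.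
pose b (u t : 'rV[R]_n) := (u *m S *m t^T) 0 0.
have bC : b w v = b v w.
  have eT (X : 'M[R]_1) : X 0 0 = X^T 0 0 by rewrite mxE.
  by rewrite /b (eT (w *m S *m v^T)) trmx_mul trmx_mul trmxK symS mulmxA.
have bD : b (v + w) (v + w) = b v v + b v w + b v w + b w w.
  rewrite -{2}bC /b linearD /= !mulmxDl !mulmxDr.
  have eD (X Y : 'M[R]_1) : (X + Y) 0 0 = X 0 0 + Y 0 0 by rewrite mxE.
  by rewrite !eD; ring.
have bB : b (v - w) (v - w) = b v v - b v w - b v w + b w w.
  rewrite -{2}bC /b linearB /= !mulmxBl !mulmxBr.
  have eB (X Y : 'M[R]_1) : (X - Y) 0 0 = X 0 0 - Y 0 0 by rewrite !mxE.
  by rewrite !eB; ring.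
rewrite mulmxA -/(b v w) -/(b w w).
have := pos (v + w); have := pos (v - w); have := pos w; have := pos v.
rewrite -/(b v v) -/(b w w) -/(b (v - w) (v - w)) -/(b (v + w) (v + w)) bD bB.
move: v1; rewrite -/(b v v) ler_norml.
by set bv := b v v; set bw := b w w; set bb := b v w; lra.
Qed.

Lemma dual_norm_ge (g : riemannian_metric A) x (p : cotangent A x)
    (v : tangent A x) : tnorm g v <= 1 -> `|pairing p v| <= dual_norm g p.
Proof.
move=> v1; apply: ub_le_sup; last by exists v.
have [B bB] := posdef_dual_bound p (gram_sym g x) (@gram_posdef _ _ _ _ g x).
exists B => _ [w /= w1 <-]; apply: bB.
move: w1; rewrite /tnorm -{1}(sqrtr1 R) => w1.
by rewrite -ler_sqrt.
Qed.

Lemma dual_norm0 (g : riemannian_metric A) x :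
  dual_norm g (0 : cotangent A x) = 0.
Proof.
rewrite /dual_norm (_ : [set _ | _ in _] = [set 0]) ?sup1//.
apply/seteqP; split => [_ [v _ <-]|_ ->] /=.
  by rewrite /pairing mulmx0 mxE normr0.
exists 0; last by rewrite /pairing mulmx0 mxE normr0.
by rewrite /= /tnorm !mul0mx mxE sqrtr0 ler01.
Qed.

(** The [j]-th coordinate function is unchanged by the round trip from [c] to [chart_at A x] and
    back; comparing gradients gives the [j]-th column of the product of the Jacobians. *)
Lemma dchart_invK c x : charts A c -> cdom c x ->
  dchart_inv A c (cmap c x) *m dchart A c x = 1%:M.
Proof.
move=> Ac cx; rewrite /dchart_inv /dchart cmapK//.
have [Ad dx] := chart_atP A x; set d := chart_at A x in Ad dx *.
have [d1 _] := nbhs_singleton (C1map_transition Ac Ad cx dx).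
have [d2 _] := nbhs_singleton (C1map_transition Ad Ac dx cx).
apply/row_matrixP => i; apply/rowP => j.
pose pj := fun y : 'rV[R]_n => y 0 j.
have gj := isgrad_coord j (cmap c x).
have g2 : isgrad (pj \o (cmap c \o cinv d)) (cmap d x)
    ('J (cmap c \o cinv d) (cmap d x) *m delta_mx j 0).
  by apply: (isgrad_comp d2); rewrite /= cmapK.
have g1 : isgrad ((pj \o (cmap c \o cinv d)) \o (cmap d \o cinv c)) (cmap c x)
   ('J (cmap d \o cinv c) (cmap c x) *m
     ('J (cmap c \o cinv d) (cmap d x) *m delta_mx j 0)).
  by apply: (isgrad_comp d1); rewrite /= cmapK.
have e : \forall y \near cmap c x,
    ((pj \o (cmap c \o cinv d)) \o (cmap d \o cinv c)) y = pj y.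
  apply: filterS2 (nbhs_cimg cx) (nbhs_cinv cx (nbhs_cdom dx)) => y [cy ey] dy.
  by rewrite /= cmapK// ey.
have := isgradE (isgrad_near e g1); rewrite (isgradE gj) => /esym.
set J1 := 'J (cmap d \o cinv c) _; set J2 := 'J (cmap c \o cinv d) _.
rewrite mulmxA -colE => /colP/(_ i).
rewrite [LHS]mxE [RHS]mxE eqxx andbT => eJ.
by rewrite [LHS]mxE eJ [RHS]mxE [RHS]mxE.
Qed.

(** Superlinearity with slope 1 bounds the dual norm by C + C1 where H <= C. Pairing with a
    coordinate vector of [c], rescaled to norm at most 1, turns this into a bound on one
    coordinate. *)
Lemma superlinear_coercive (g : riemannian_metric A) H :
  uniformly_superlinear H g -> Hcoercive H.
Proof.
move=> /(_ 1 ler01)[C1 hC1] C c x Ac cx.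
pose Gc y := dchart_inv A c y *m gram g (cinv c y) *m (dchart_inv A c y)^T.
have cG : {for cmap c x, continuous Gc}.
  by have := gram_smooth g Ac 0%N; apply; exists x.
(* The added 1 gives a strict bound on the Gram matrix that persists near [x], and also b >= 1, so
   that the vector [v] below has squared norm at most b^-2 b <= 1. *)
pose b := `|Gc (cmap c x)| + 1.
have b1 : 1 <= b by rewrite /b lerDr.
have b0 : 0 < b by exact: lt_le_trans b1.
exists (b * (C + C1)).
have nb : \forall z \near x, `|Gc (cmap c z)| < b.
  apply: (@nbhs_cmap _ _ _ c x (fun y => `|Gc y| < b) cx).
  have cN : (fun y => `|Gc y|) @ cmap c x --> `|Gc (cmap c x)|.
    exact: (cvg_norm cG).
  have bb : `|Gc (cmap c x)| < b by rewrite /b ltrDl.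
  exact: (cvgr_lt _ cN _ bb).
apply: filterS2 (nbhs_cdom cx) nb => z cz zb q Hq i.
pose v : tangent A z := b^-1 *: ((delta_mx 0 i : 'rV[R]_n) *m dchart_inv A c (cmap c z)).
have v1 : tnorm g v <= 1.
  rewrite /tnorm -{1}(sqrtr1 R) ler_wsqrtr// /v.
  have qZ (t : R) (u : 'rV[R]_n) (S : 'M[R]_n) :
      ((t *: u) *m S *m (t *: u)^T) 0 0 = t * (t * (u *m S *m u^T) 0 0).
    have -> : (t *: u)^T = t *: u^T by apply/matrixP => k l; rewrite !mxE.
    rewrite -2!scalemxAl -scalemxAr [LHS]mxE; congr (_ * _).
    by rewrite [LHS]mxE.
  rewrite qZ.
  have -> : ((delta_mx 0 i : 'rV[R]_n) *m dchart_inv A c (cmap c z) *m gram g z *m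
     ((delta_mx 0 i : 'rV[R]_n) *m dchart_inv A c (cmap c z))^T) 0 0 = Gc (cmap c z) i i.
    have -> : Gc (cmap c z) i i =
      ((delta_mx 0 i : 'rV[R]_n) *m Gc (cmap c z) *m
        (delta_mx i 0 : 'cV[R]_n)) 0 0.
      by rewrite -rowE -colE [RHS]mxE [RHS]mxE.
    by rewrite /Gc cmapK// trmx_mul trmx_delta !mulmxA.
  have Gb : Gc (cmap c z) i i <= b.
    apply: le_trans (ltW zb); apply: le_trans (ler_norm _) _.
    rewrite [leRHS]/Num.Def.normr/= mx_normrE.
    exact: (le_bigmax _ (fun k : 'I_n * 'I_n => `|Gc (cmap c z) k.1 k.2|) (i, i)).
  have bi1 : b^-1 <= 1 by rewrite invf_le1.
  have bi0 : 0 < b^-1 by rewrite invr_gt0.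
  have h : b^-1 * Gc (cmap c z) i i <= 1 by rewrite ler_pdivrMl// mulr1.
  by nra.
have := dual_norm_ge (dchart A c z *m q : cotangent A z) v1.
have -> : pairing (dchart A c z *m q : cotangent A z) v = b^-1 * q i 0.
  rewrite /pairing /v -scalemxAl [LHS]mxE; congr (_ * _).
  rewrite mulmxA -(mulmxA (delta_mx 0 i)) dchart_invK// mulmx1.
  by rewrite -rowE mxE.
rewrite normrM gtr0_norm ?invr_gt0// ler_pdivrMl// => h1.
apply: le_trans h1 _; rewrite ler_pM2l//.
have := hC1 z (dchart A c z *m q); rewrite mul1r => h2.
by rewrite -lerBlDr; apply: le_trans h2 Hq.
Qed.

Lemma superlinear_lower (g : riemannian_metric A) H :
  uniformly_superlinear H g -> exists C, forall x p, C <= H x p.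
Proof.
move=> /(_ 0 (lexx 0))[C hC]; exists (- C) => x p.
by have := hC x p; rewrite mul0r sub0r.
Qed.

Lemma bounded_upper (g : riemannian_metric A) H :
  uniformly_bounded H g -> exists C, forall x, H x 0 <= C.
Proof.
move=> /(_ 0 (lexx 0)); set S := ereal_sup _ => S1.
have hS x : ((H x 0)%:E <= S)%E.
  by apply: ereal_sup_ubound; exists x, 0; rewrite dual_norm0.
(* A point of [M] is needed to exclude [S = -oo], the supremum of the empty set. *)
have [[x _]|nM] := pselect ([set: M] !=set0); last first.
  by exists 0 => x; exfalso; apply: nM; exists x.
have S2 : S \is a fin_num.
  rewrite fin_numE -ltey S1 andbT -ltNye.
  by apply: lt_le_trans (hS x); rewrite ltNyr.
by exists (fine S) => z; rewrite -lee_fin fineK.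
Qed.

End Hamiltonian.

Opaque mC1 C1 dfun.

(** * Local viscosity sub- and supersolutions *)

Section LocalViscosity.
Context {R : realType} {n : nat} {M : topologicalType}.
Variable A : smooth_atlas R n M.
Implicit Types (c d : chart R n M) (x z : M) (phi psi w : M -> R) (H : hamiltonian A).

(* Tests are local; the right-hand side [f] is an arbitrary function, so that it
   may depend on [w] itself, as in the discounted equation. *)
Definition lsub_at H w x (s : R) := forall phi, mC1 A phi x -> phi x = w x ->
  (\forall z \near x, w z <= phi z) -> H x (dfun A phi x) <= s.

Definition lsuper_at H w x (s : R) := forall phi, mC1 A phi x -> phi x = w x ->
  (\forall z \near x, phi z <= w z) -> s <= H x (dfun A phi x).

Definition lsub H w (f : M -> R) :=
  continuous w /\ forall x, lsub_at H w x (f x).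

Definition lsuper H w (f : M -> R) :=
  continuous w /\ forall x, lsuper_at H w x (f x).

(** The involution H(x, p) -> -H(x, -p), u -> -u exchanges the two notions; with [lsuper_opp_at] it
    transfers [lsub_limit] to supersolutions. *)
Lemma lsub_opp H w f : lsuper H w f ->
  lsub (fun x p => - H x (- p)) (fun x => - w x) (fun x => - f x).
Proof.
move=> [cw sw]; split; first by move=> x; exact: cvgN (cw x).
move=> x phi cphi e le; rewrite lerN2 -dfunN//; apply: sw.
- exact: mC1N.
- by rewrite e opprK.
- by apply: filterS le => z; rewrite lerNl.
Qed.

Lemma lsuper_opp_at H w x s :
  lsub_at (fun x p => - H x (- p)) (fun x => - w x) x (- s) ->
  lsuper_at H w x s.
Proof.
move=> sw phi cphi e le.
have := sw _ (mC1N cphi); rewrite e => /(_ erefl).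
rewrite dfunN// opprK lerN2; apply.
by apply: filterS le => z; rewrite lerN2.
Qed.

(** Coordinate balls are compact, so maxima exist without compactness of [M]. The last clause is the
    useful one: a maximum in the open ball is a local maximum on [M], hence a place to test. *)
Lemma max_on_ball c (y0 : 'rV[R]_n) (r : R) (f : M -> R) : 0 <= r ->
  (forall y, sqn (y - y0) <= r -> [/\ cdom c (cinv c y), cmap c (cinv c y) = y
     & {for cinv c y, continuous f}]) ->
  exists y, [/\ sqn (y - y0) <= r,
    forall y', sqn (y' - y0) <= r -> f (cinv c y') <= f (cinv c y) &
    sqn (y - y0) < r -> \forall z \near cinv c y, f z <= f (cinv c y)].
Proof.
move=> r0 hr; pose K := [set y | sqn (y - y0) <= r].
have K0 : K !=set0 by exists y0; rewrite /K /= subrr sqn0.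
have cf : {within K, continuous (f \o cinv c)}.
  rewrite continuous_subspace_in => y yK; rewrite inE in yK.
  have [cy ey fy] := hr y yK.
  apply: continuous_subspaceT_for => //.
  apply: continuous_comp => //; apply: cinv_continuous.
  by exists (cinv c y).
have [y yK ymax] := compact_EVT_max K0 (@sqn_ball_compact _ _ y0 r) cf.
rewrite inE in yK; exists y; split => //.
  by move=> y' y'K; apply: (ymax y'); rewrite inE.
move=> ylt; have [cy ey _] := hr y yK.
have ny : \forall t \near cmap c (cinv c y), sqn (t - y0) < r.
  rewrite ey; exact: (cvgr_lt _ (@sqn_continuous _ _ y0 y) _ ylt).
apply: filterS2 (nbhs_cdom cy) (nbhs_cmap cy ny) => z cz /ltW zr.
have := ymax (cmap c z); rewrite inE => /(_ zr).
by rewrite /= cmapK.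
Qed.

Definition penalized phi x0 z : R :=
  phi z + sqn (cmap (chart_at A x0) z - cmap (chart_at A x0) x0).

Lemma mC1_penalty x0 (y0 : 'rV[R]_n) z : cdom (chart_at A x0) z ->
  mC1 A (fun z => sqn (cmap (chart_at A x0) z - y0)) z.
Proof.
move=> cz; have [Ac _] := chart_atP A x0.
exact: (mC1_pull Ac cz (C1_sqn y0 _)).
Qed.

Lemma mC1_penalized phi x0 : mC1 A phi x0 -> mC1 A (penalized phi x0) x0.
Proof.
move=> cphi; have [_ cx] := chart_atP A x0.
exact: (mC1D cphi (mC1_penalty _ cx)).
Qed.

Lemma dfun_penalized phi x0 : mC1 A phi x0 ->
  dfun A (penalized phi x0) x0 = dfun A phi x0.
Proof.
move=> cphi; have [Ac cx] := chart_atP A x0.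
have e0 : phi x0 = penalized phi x0 x0.
  by rewrite /penalized subrr sqn0 addr0.
apply/esym/(dfun_le cphi (mC1_penalized cphi) e0).
by apply: filterE => z; rewrite /penalized lerDl sqn_ge0.
Qed.

(* The quadratic penalty makes [x0] a strict maximum of [w - phi], so any [w']
   which is close to [w] near [x0] is touched at a nearby interior point. *)
Lemma perturbed_test phi w x0 (U : set M) (e : R) :
  mC1 A phi x0 -> phi x0 = w x0 -> (\forall z \near x0, w z <= phi z) ->
  nbhs x0 U -> 0 < e ->
  exists (K : set M) (d : R), [/\ compact K, K `<=` U, K x0, 0 < d & d <= e] /\
    (forall w', (forall z, K z -> {for z, continuous w'}) ->
      (forall z, K z -> w' z <= w z + d) -> w x0 - d <= w' x0 ->
      exists2 x, K x & w x - d <= w' x /\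
        forall H s, lsub_at H w' x s -> H x (dfun A (penalized phi x0) x) <= s).
Proof.
move=> cphi e0 wphi nU egt0; have [Ac cx] := chart_atP A x0.
set c := chart_at A x0 in Ac cx *; pose y0 := cmap c x0.
have good : \forall y \near y0, [/\ cdom c (cinv c y), cmap c (cinv c y) = y,
    U (cinv c y), w (cinv c y) <= phi (cinv c y) & mC1 A phi (cinv c y)].
  have n1 := nbhs_cimg cx; have n2 := nbhs_cinv cx nU.
  have n3 := nbhs_cinv cx wphi; have n4 := nbhs_cinv cx (mC1_near cphi).
  near=> y; split.
  - by have [] := near n1 y.
  - by have [] := near n1 y.
  - by near: y.
  - by near: y.
  - by near: y.
have [r r0 gr] := nbhs_sqn good.
pose B := [set y : 'rV[R]_n | sqn (y - y0) <= r ^+ 2].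
have r20 : 0 < r ^+ 2 by rewrite exprn_gt0.
have By0 : B y0 by rewrite /B /= subrr sqn0 ltW.
have ex0 : cinv c y0 = x0 by rewrite /y0 cmapK.
(* A maximum [y] of [w' - psi] satisfies |y - y0|^2 <= 2 d: the value there is at least the one at
   [x0], hence at least -d, while [w' <= w + d <= phi + d]. With 3 d <= r^2 it is interior to the
   ball. *)
exists (cinv c @` B), (Num.min e (r ^+ 2 / 3)); split; first split.
- apply: continuous_compact; last exact: sqn_ball_compact.
  rewrite continuous_subspace_in => y yB; rewrite inE in yB.
  have [cy ey _ _ _] := gr y yB.
  apply: continuous_subspaceT_for => //; apply: cinv_continuous.
  by exists (cinv c y).
- by move=> _ [y /gr[_ _ Uy _ _] <-].
- by exists y0.
- by rewrite lt_min egt0 divr_gt0.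
- by rewrite ge_min lexx.
move=> w' cw' w'w w'x0; set dl := Num.min e _ in w'w w'x0 *.
have dl3 : 3 * dl <= r ^+ 2.
  by rewrite mulrC -ler_pdivlMr// ge_min lexx orbT.
have dl0 : 0 < dl by rewrite lt_min egt0 divr_gt0.
pose psi := penalized phi x0.
have cpsi y : B y -> mC1 A psi (cinv c y).
  move=> /gr[cy _ _ _ cp]; exact: (mC1D cp (mC1_penalty _ cy)).
have epsi y : B y -> psi (cinv c y) = phi (cinv c y) + sqn (y - y0).
  by move=> /gr[_ ey _ _ _]; rewrite /psi /penalized -/c ey.
have [y [yB ymax yloc]] : exists y, [/\ sqn (y - y0) <= r ^+ 2,
    forall y', sqn (y' - y0) <= r ^+ 2 ->
      w' (cinv c y') - psi (cinv c y') <= w' (cinv c y) - psi (cinv c y) &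
    sqn (y - y0) < r ^+ 2 -> \forall z \near cinv c y,
      w' z - psi z <= w' (cinv c y) - psi (cinv c y)].
  apply: (@max_on_ball c y0 (r ^+ 2) (fun z => w' z - psi z)); first exact: ltW.
  move=> y yB; have [cy ey _ _ _] := gr y yB; split => //.
  have c1 : {for cinv c y, continuous w'} by apply: cw'; exists y.
  exact: (cvgB c1 (mC1_continuous (cpsi y yB))).
have := ymax y0 By0; rewrite ex0 {1}/psi {1}/penalized subrr sqn0 addr0 e0.
rewrite (epsi y yB) => h1.
have [_ _ _ h2 _] := gr y yB.
have h3 := w'w (cinv c y) (ex_intro2 _ _ y yB erefl).
have h4 := sqn_ge0 (y - y0).
have ylt : sqn (y - y0) < r ^+ 2 by rewrite lt_neqAle yB andbT; apply/eqP => h; lra.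
exists (cinv c y); first by exists y.
split; first by lra.
move=> H s sw'; rewrite -[dfun A psi _]addr0.
pose k := w' (cinv c y) - psi (cinv c y).
have ck : mC1 A (cst k) (cinv c y) by exact: mC1_cst.
rewrite -(@dfun_cst _ _ _ A k (cinv c y)) -(dfunD (cpsi y yB) ck).
apply: (sw' _ (mC1D (cpsi y yB) ck)).
  by rewrite addrC subrK.
by apply: filterS (yloc ylt) => z; rewrite lerBlDr addrC.
Unshelve. all: by end_near. Qed.

(** Nothing need touch [w] from above at [x0] itself, but a steep paraboloid centred there touches
    at a nearby point, where C0 <= H <= f; continuity of [f] does the rest. It yields the a priori
    bound on the discounted equation. *)
Lemma lsub_lower H w f (C0 : R) : (forall x p, C0 <= H x p) -> lsub H w f ->
  continuous f -> forall x, C0 <= f x.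
Proof.
move=> HC0 [cw sw] cf x0; rewrite leNgt; apply/negP => lt0.
have [Ac cx] := chart_atP A x0.
set c := chart_at A x0 in Ac cx *; pose y0 := cmap c x0.
have good : \forall y \near y0, [/\ cdom c (cinv c y), cmap c (cinv c y) = y &
    f (cinv c y) < C0].
  have nf : \forall z \near x0, f z < C0 by exact: (cvgr_lt _ (cf x0) _ lt0).
  have n1 := nbhs_cimg cx; have n2 := nbhs_cinv cx nf.
  near=> y; split; [by have [] := near n1 y|by have [] := near n1 y|by near: y].
have [r r0 gr] := nbhs_sqn good.
have r20 : 0 < r ^+ 2 by rewrite exprn_gt0.
have [y1 [y1B y1max _]] : exists y, [/\ sqn (y - y0) <= r ^+ 2,
    forall y', sqn (y' - y0) <= r ^+ 2 -> w (cinv c y') <= w (cinv c y) &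
    sqn (y - y0) < r ^+ 2 -> \forall z \near cinv c y, w z <= w (cinv c y)].
  apply: max_on_ball; first exact: ltW.
  by move=> y /gr[cy ey _]; split => //; exact: cw.
(* On the sphere |y - y0|^2 = r^2 the penalty is w(y1) - w(x0) + 1, so [w - psi] is at most w(x0) -
   1 there and its maximum is interior. *)
pose k := (w (cinv c y1) - w x0 + 1) / r ^+ 2.
pose psi z : R := k * sqn (cmap c z - y0).
have cpsi y : sqn (y - y0) <= r ^+ 2 -> mC1 A psi (cinv c y).
  move=> /gr[cy _ _]; exact: (mC1M (@mC1_cst _ _ _ A k _) (mC1_penalty _ cy)).
have [y [yB ymax yloc]] : exists y, [/\ sqn (y - y0) <= r ^+ 2,
    forall y', sqn (y' - y0) <= r ^+ 2 ->
      w (cinv c y') - psi (cinv c y') <= w (cinv c y) - psi (cinv c y) &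
    sqn (y - y0) < r ^+ 2 -> \forall z \near cinv c y,
      w z - psi z <= w (cinv c y) - psi (cinv c y)].
  apply: (@max_on_ball c y0 (r ^+ 2) (fun z => w z - psi z)); first exact: ltW.
  move=> y yB; have [cy ey _] := gr y yB; split => //.
  exact: (cvgB (cw _) (mC1_continuous (cpsi y yB))).
have By0 : sqn (y0 - y0) <= r ^+ 2 by rewrite subrr sqn0 ltW.
have ex0 : cinv c y0 = x0 by rewrite /y0 cmapK.
have [cy ey fy] := gr y yB.
have := ymax y0 By0; rewrite ex0 /psi subrr sqn0 mulr0 subr0 ey => h1.
have h2 := y1max y yB.
have ylt : sqn (y - y0) < r ^+ 2.
  rewrite lt_neqAle yB andbT; apply/eqP => h; move: h1; rewrite h /k divfK ?gt_eqF//.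
  lra.
have := HC0 (cinv c y) (dfun A (fun z => psi z + (w (cinv c y) - psi (cinv c y))) (cinv c y)).
apply/negP; rewrite -ltNge; apply: le_lt_trans fy.
apply: (sw _ _ (mC1D (cpsi y yB) (@mC1_cst _ _ _ A _ _))).
- by rewrite addrC subrK.
- by apply: filterS (yloc ylt) => z; rewrite lerBlDr addrC.
Unshelve. all: by end_near. Qed.

End LocalViscosity.

(** * Equi-Lipschitz estimate for subsolutions *)

Section Compactness.
Context {R : realType} {n : nat} {M : topologicalType}.
Variable A : smooth_atlas R n M.
Implicit Types (c d : chart R n M) (x z : M) (phi psi w : M -> R) (H : hamiltonian A).

Lemma sqnD_le (u v : 'rV[R]_n) : sqn (u + v) <= 2 * sqn u + 2 * sqn v.
Proof.
rewrite !sqnE !mulr_sumr -big_split /=; apply: ler_sum => i _.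
by rewrite mxE; have := sqr_ge0 (u 0 i - v 0 i); nra.
Qed.

Lemma sqnC (y z : 'rV[R]_n) : sqn (y - z) = sqn (z - y).
Proof. by rewrite -sqnN opprB. Qed.

(* Test with the cone [L |y - z|], plus a term vanishing for [|y - z|^2 <= t] and
   so steep that the maximum of [w - cone] is interior; away from the vertex the
   gradient of the cone has norm at least [L], which coercivity excludes. *)
Lemma lsub_lipschitz H (C : R) x0 : Hcoercive H ->
  let c := chart_at A x0 in
  exists L t : R, [/\ 0 < L, 0 < t & forall w, lsub H w (cst C) ->
    forall y z : 'rV[R]_n, sqn (z - cmap c x0) <= t -> sqn (y - z) <= t ->
    w (cinv c y) - w (cinv c z) <= L * Num.sqrt (sqn (y - z))].
Proof.
move=> coH c; have [Ac cx] := chart_atP A x0; rewrite -/c in Ac cx.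
pose y0 := cmap c x0.
have [B hB] := coH C c x0 Ac cx.
have good : \forall y \near y0, [/\ cdom c (cinv c y), cmap c (cinv c y) = y &
    forall q : 'cV[R]_n, H (cinv c y) (dchart A c (cinv c y) *m q) <= C ->
      forall i, `|q i 0| <= B].
  have n1 := nbhs_cimg cx; have n2 := nbhs_cinv cx hB.
  near=> y; split; [by have [] := near n1 y|by have [] := near n1 y|].
  by near: y; exact: n2.
have [r r0 gr] := nbhs_sqn good.
have r20 : 0 < r ^+ 2 by rewrite exprn_gt0.
(* Chosen so that L^2 > n B^2: coordinates bounded by [B] force a squared gradient norm of at most n
   B^2. *)
pose L := (n%:R + 1) * (`|B| + 1).
(* If |z - y0|^2 <= t and |y' - z|^2 <= 4 t, then |y' - y0|^2 <= 2 (4 t) + 2 t = r^2, so the ball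
   around [z] stays in the good region. *)
pose t := r ^+ 2 / 10.
have n0 : (0 : R) <= n%:R by rewrite ler0n.
have t0 : 0 < t by rewrite divr_gt0.
have L0 : 0 < L by rewrite mulr_gt0 ?ltr_wpDl.
have LB : n%:R * B ^+ 2 < L ^+ 2.
  have B0 := normr_ge0 B; rewrite -(real_normK (num_real B)) /L.
  set b := `|B| in B0 *; set m := n%:R in n0 *.
  have h1 : m * b ^+ 2 <= (m + 1) ^+ 2 * b ^+ 2.
    by rewrite ler_wpM2r ?sqr_ge0//; nra.
  apply: le_lt_trans h1 _; rewrite exprMn ltr_pM2l; last by rewrite exprn_gt0// ltr_wpDl.
  by nra.
exists L, t; split => // w [cw sw] y z zt yt.
have gz y' : sqn (y' - z) <= 4 * t -> sqn (y' - y0) <= r ^+ 2.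
  move=> h; rewrite -(subrK z y') -addrA; apply: le_trans (sqnD_le _ _) _.
  by move: h zt; rewrite /t; lra.
have t40 : 0 <= 4 * t by rewrite mulr_ge0// ltW.
have [y1 [y1B y1max _]] : exists y, [/\ sqn (y - z) <= 4 * t,
    forall y', sqn (y' - z) <= 4 * t -> w (cinv c y') <= w (cinv c y) &
    sqn (y - z) < 4 * t -> \forall z \near cinv c y, w z <= w (cinv c y)].
  apply: max_on_ball => // y' /gz/gr[cy ey _].
  by split => //; exact: cw.
(* At |y - z|^2 = 4 t the truncated term is (3 t)^2, so the cone there exceeds the rise of [w] above
   w(z), and the maximum of [w - cone] is not on that sphere. Only [k] depends on [w]; [L] and [t]
   do not, which makes the estimate uniform. *)
pose k := (w (cinv c y1) - w (cinv c z) + 1) / (3 * t) ^+ 2.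
have k0 : 0 < k.
  rewrite divr_gt0// ?exprn_gt0 ?mulr_gt0// ltr_wpDl// subr_ge0; apply: y1max.
  by rewrite subrr sqn0.
pose cone (x : 'rV[R]_n) := L * Num.sqrt (sqn (x - z)) + k * possq (sqn (x - z) - t).
have ccone : continuous cone.
  have cs := @sqn_continuous R n z.
  have cp : continuous (@possq R).
    by move=> s; apply: differentiable_continuous; apply/derivable1_diffP;
       have [] := is_derive_possq s.
  move=> x.
  have c1 : {for x, continuous (Num.sqrt \o (fun u : 'rV[R]_n => sqn (u - z)))}.
    exact: continuous_comp (cs x) (@sqrt_continuous R _).
  have c0 : {for x, continuous (fun u : 'rV[R]_n => sqn (u - z) - t)}.
    exact: cvgB (cs x) (cvg_cst t).
  have c2 : {for x, continuous (@possq R \o (fun u : 'rV[R]_n => sqn (u - z) - t))}.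
    exact: continuous_comp c0 (cp _).
  exact: (cvgD (cvgM (cvg_cst L) c1) (cvgM (cvg_cst k) c2)).
have [y2 [y2B y2max y2loc]] : exists y, [/\ sqn (y - z) <= 4 * t,
    forall y', sqn (y' - z) <= 4 * t ->
      w (cinv c y') - cone (cmap c (cinv c y')) <=
      w (cinv c y) - cone (cmap c (cinv c y)) &
    sqn (y - z) < 4 * t -> \forall x \near cinv c y,
      w x - cone (cmap c x) <= w (cinv c y) - cone (cmap c (cinv c y))].
  apply: (@max_on_ball _ _ _ c z _ (fun x => w x - cone (cmap c x))) => //.
  move=> y' /gz/gr[cy ey _]; split => //.
  have c1 : {for cinv c y', continuous (cone \o cmap c)}.
    exact: continuous_comp (cmap_continuous cy) (ccone _).
  exact: cvgB (cw _) c1.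
have [cy2 ey2 coy2] := gr _ (gz _ y2B).
have eK y' : sqn (y' - z) <= 4 * t -> cmap c (cinv c y') = y'.
  by move=> /gz/gr[].
have zz : sqn (z - z) <= 4 * t by rewrite subrr sqn0.
have conez : cone z = 0.
  by rewrite /cone subrr sqn0 sqrtr0 mulr0 add0r possq_neg ?mulr0// sub0r oppr_le0 ltW.
have y2z : y2 = z.
  apply/eqP/negPn/negP => ne.
  have sp : 0 < sqn (y2 - z).
    rewrite lt_neqAle sqn_ge0 andbT eq_sym; apply/eqP => /sqn_eq0/eqP.
    by rewrite subr_eq0 (negbTE ne).
  have y2lt : sqn (y2 - z) < 4 * t.
    rewrite lt_neqAle y2B andbT; apply/eqP => h.
    have := y2max z zz; rewrite !eK// conez subr0 {1}/cone h.
    have -> : 4 * t - t = 3 * t by lra.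
    rewrite possq_pos; last by rewrite mulr_ge0// ltW.
    rewrite /k divfK; last by rewrite gt_eqF// exprn_gt0// mulr_gt0.
    have := y1max y2 y2B; have : 0 <= L * Num.sqrt (4 * t).
      by rewrite mulr_ge0 ?sqrtr_ge0// ltW.
    by lra.
  have zy2 : z != y2 by rewrite eq_sym.
  have cc : C1 cone (cmap c (cinv c y2)) by rewrite ey2; exact: C1_cone.
  pose k2 := w (cinv c y2) - cone (cmap c (cinv c y2)).
  have m1 := mC1_pull Ac cy2 cc.
  have m2 : mC1 A (cst k2) (cinv c y2) by exact: mC1_cst.
  have := sw _ _ (mC1D m1 m2).
  rewrite (dfunD m1 m2) dfun_cst addr0 (dfun_pull Ac cy2 cc) ey2.
  rewrite (isgradE (isgrad_cone L k t zy2)).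
  have e1 : (cone \o cmap c) (cinv c y2) + cst k2 (cinv c y2) = w (cinv c y2).
    by rewrite /= /k2 addrC subrK.
  have l1 : \forall z0 \near cinv c y2, w z0 <= (cone \o cmap c) z0 + cst k2 z0.
    by apply: filterS (y2loc y2lt) => x; rewrite lerBlDr addrC.
  move=> /(_ e1 l1)/coy2 {e1 l1 m1 m2}.
  set s := L / _ + _ => hs.
  have sL : L <= s * Num.sqrt (sqn (y2 - z)).
    rewrite /s mulrDl divfK ?gt_eqF ?sqrtr_gt0// lerDl mulr_ge0 ?sqrtr_ge0//.
    by rewrite mulr_ge0// ?le_max ?lexx ?orbT// mulr_ge0// ltW.
  have : L ^+ 2 <= n%:R * B ^+ 2.
    have h1 : L ^+ 2 <= (s * Num.sqrt (sqn (y2 - z))) ^+ 2.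
      by rewrite ler_pXn2r// nnegrE ?(le_trans _ sL)// ltW.
    apply: le_trans h1 _; rewrite exprMn sqr_sqrtr ?sqn_ge0// sqnE mulr_sumr.
    have -> : n%:R * B ^+ 2 = \sum_(i < n) B ^+ 2.
      by rewrite sumr_const card_ord mulr_natl.
    apply: ler_sum => i _; have := hs i; rewrite !mxE -exprMn => hi.
    rewrite -(real_normK (num_real (s * _))) ler_pXn2r// nnegrE//.
    exact: le_trans hi.
  by rewrite leNgt LB.
have yB : sqn (y - z) <= 4 * t by apply: le_trans yt _; lra.
have := y2max y yB; rewrite y2z !eK// conez subr0 lerBlDr -lerBlDl => h.
rewrite lerBlDr addrC -lerBlDr; apply: le_trans (_ : w (cinv c y) - cone y <= _).
  rewrite lerD2l lerN2 /cone possq_neg ?mulr0 ?addr0//; lra.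
by rewrite lerBlDr -lerBlDl.
Unshelve. all: by end_near. Qed.

Lemma lsub_equicontinuous H (C : R) x0 (e : R) : Hcoercive H -> 0 < e ->
  \forall z \near x0, forall w, lsub H w (cst C) -> `|w z - w x0| <= e.
Proof.
move=> coH e0; have [L [t [L0 t0 hL]]] := lsub_lipschitz C x0 coH.
have [Ac cx] := chart_atP A x0; set c := chart_at A x0 in Ac cx hL *.
pose m := Num.min t ((e / L) ^+ 2).
have m0 : 0 < m by rewrite lt_min t0 exprn_gt0// divr_gt0.
have nz := nbhs_cmap cx (sqn_nbhs (cmap c x0) m0).
apply: filterS2 (nbhs_cdom cx) nz => z cz zm w sw.
have zt : sqn (cmap c z - cmap c x0) <= t by apply: le_trans (ltW zm) _; rewrite ge_min lexx.
have Le : L * Num.sqrt (sqn (cmap c z - cmap c x0)) <= e.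
  rewrite -ler_pdivlMl// [L^-1 * e]mulrC.
  rewrite -[leRHS]gtr0_norm ?divr_gt0// -sqrtr_sqr ler_wsqrtr//.
  by apply: le_trans (ltW zm) _; rewrite ge_min lexx orbT.
have z0 : sqn (cmap c x0 - cmap c x0) <= t by rewrite subrr sqn0 ltW.
have zt' : sqn (cmap c x0 - cmap c z) <= t by rewrite sqnC.
have h1 := hL w sw (cmap c z) (cmap c x0) z0 zt.
have h2 := hL w sw (cmap c x0) (cmap c z) zt zt'.
move: h1 h2; rewrite (sqnC (cmap c x0)) !cmapK// => h1 h2.
by rewrite ler_norml; apply/andP; split; lra.
Qed.

End Compactness.

(** * Stability under limits and suprema *)

Section Stability.
Context {R : realType} {n : nat} {M : topologicalType}.
Variable A : smooth_atlas R n M.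
Implicit Types (c d : chart R n M) (x z : M) (phi psi w : M -> R) (H : hamiltonian A).

Lemma penalized_nbhs H phi x0 (s : R) : Hcont H -> mC1 A phi x0 ->
  s < H x0 (dfun A phi x0) ->
  \forall z \near x0, s < H z (dfun A (penalized A phi x0) z).
Proof.
move=> cH cphi; rewrite -(dfun_penalized cphi).
exact: (cvgr_gt _ (cH _ _ (mC1_penalized cphi))).
Qed.

(** A violation by [w] at [x0] persists, for the penalized test function, on a neighbourhood;
    [perturbed_test] then makes some [w_ i] be tested inside it. The product filter in the
    hypotheses expresses locally uniform convergence, and the right-hand sides may vary with [i] and
    with the point. *)
Lemma lsub_limit (I : Type) (F : set_system I) {PF : ProperFilter F} H
    (w_ f_ : I -> M -> R) w x0 (s : R) : Hcont H ->
  (forall i, lsub H (w_ i) (f_ i)) ->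
  (forall x (e : R), 0 < e -> \forall z \near x & i \near F, `|w_ i z - w z| < e) ->
  (forall e : R, 0 < e -> \forall z \near x0 & i \near F, f_ i z < s + e) ->
  lsub_at H w x0 s.
Proof.
move=> cH sw cw cf phi cphi e0 wphi; rewrite leNgt; apply/negP => lt0.
pose e := (H x0 (dfun A phi x0) - s) / 2.
have ep : 0 < e by rewrite divr_gt0// subr_gt0.
have lt1 : s + e < H x0 (dfun A phi x0) by rewrite /e; lra.
have [[/= U V] [nU FV UV]] := cf e ep.
have n1 := penalized_nbhs cH cphi lt1.
have [K [d [[cK KU Kx0 d0 _] hK]]] := perturbed_test cphi e0 wphi (filterI nU n1) ltr01.
(* Compactness of [K] merges the local closeness conditions into a single set of indices in [F]. *)
have nK : \near F, K `<=` (fun i x => `|w_ i x - w x| < d) F.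
  by move/compact_near_coveringP : cK; apply=> x _; exact: cw.
have [i [Vi Ki]] : exists i, V i /\ forall x, K x -> `|w_ i x - w x| < d.
  by have [i [Vi Ki]] := filter_ex (filterI FV nK); exists i.
have [x Kx [_ hx]] : exists2 x, K x & w x - d <= w_ i x /\
        forall H s, lsub_at H (w_ i) x s -> H x (dfun A (penalized A phi x0) x) <= s.
  apply: hK.
  - by move=> z _; exact: (sw i).1.
  - by move=> z /Ki; rewrite ltr_norml => /andP[_ h]; lra.
  - by have := Ki x0 Kx0; rewrite ltr_norml => /andP[h _]; lra.
have [Ux hsx] := KU x Kx.
have := hx H _ ((sw i).2 x); apply/negP; rewrite -ltNge.
apply: lt_trans hsx; exact: (UV (x, i)).
Qed.

(** One-sided closeness suffices in [perturbed_test]: a member [w] of [T] lies below [u] everywhere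
    and needs to be almost [u] only at [x0], so no uniform approximation of the supremum is
    required. *)
Lemma lsub_sup (T : set (M -> R)) H u v (c lam : R) : Hcont H -> 0 <= lam ->
  continuous u -> continuous v ->
  (forall w, T w -> lsub H w (fun x => c - lam * (w x - v x))) ->
  (forall w x, T w -> w x <= u x) ->
  (forall x (e : R), 0 < e -> exists2 w, T w & u x - e < w x) ->
  lsub H u (fun x => c - lam * (u x - v x)).
Proof.
move=> cH lam0 cu cv sT Tu uT; split => // x0 phi cphi e0 uphi.
rewrite leNgt; apply/negP => lt0.
(* One third of the gap pays for the variation of the right-hand side near [x0], one for replacing
   [u] by [w] in it (at most lam d), and one keeps the contradiction strict. *)
pose e := (H x0 (dfun A phi x0) - (c - lam * (u x0 - v x0))) / 3.
have ep : 0 < e by rewrite divr_gt0// subr_gt0.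
have lt1 : c - lam * (u x0 - v x0) + 2 * e < H x0 (dfun A phi x0).
  by rewrite /e; lra.
have n1 := penalized_nbhs cH cphi lt1.
have cuv : {for x0, continuous (fun x => c - lam * (u x - v x))}.
  exact: (cvgB (cvg_cst c) (cvgM (cvg_cst lam) (cvgB (cu x0) (cv x0)))).
have lt2 : c - lam * (u x0 - v x0) < c - lam * (u x0 - v x0) + e by lra.
have n2 : \forall x \near x0, c - lam * (u x - v x) < c - lam * (u x0 - v x0) + e.
  exact: (cvgr_lt _ cuv _ lt2).
(* Dividing by lam + 1 rather than lam covers lam = 0 too. *)
have lp : 0 < lam + 1 by lra.
have elp : 0 < e / (lam + 1) by rewrite divr_gt0.
have [K [d [[cK KU _ d0 de] hK]]] := perturbed_test cphi e0 uphi (filterI n1 n2) elp.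
have [w Tw wx0] := uT x0 d d0.
have [x Kx [wx hx]] : exists2 x, K x & u x - d <= w x /\
        forall H s, lsub_at H w x s -> H x (dfun A (penalized A phi x0) x) <= s.
  apply: hK; last exact: ltW.
  - by move=> z _; exact: (sT w Tw).1.
  - by move=> z _; have := Tu w z Tw; lra.
have [h1 h2] := KU x Kx.
have := hx H _ ((sT w Tw).2 x); apply/negP; rewrite -ltNge.
apply: le_lt_trans h1; have ld : lam * d <= e.
  have : d * (lam + 1) <= e by rewrite -ler_pdivlMr.
  by nra.
by nra.
Qed.

End Stability.

(** * Perron's method: maximal subsolutions *)

Section Perron.
Context {R : realType} {n : nat} {M : topologicalType}.
Variable A : smooth_atlas R n M.
Hypothesis hT2 : hausdorff_space M.
Implicit Types (c d : chart R n M) (x z : M) (phi psi w : M -> R) (H : hamiltonian A).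

(* If a test function [phi] violated the inequality at [x0], the maximum of [u]
   and of a small upward shift of [phi - |y - y0|^2] would be a larger
   subsolution. *)
Lemma lsuper_maximal H u v (a lam : R) : Hcont H -> 0 <= lam -> continuous v ->
  lsub H u (fun x => a - lam * (u x - v x)) ->
  (forall w, lsub H w (fun x => a - lam * (w x - v x)) ->
     (forall x, u x <= w x) -> forall x, w x <= u x) ->
  lsuper H u (fun x => a - lam * (u x - v x)).
Proof.
move=> cH lam0 cv [cu su] umax; split => // x0 phi cphi e0 uphi.
rewrite leNgt; apply/negP => lt0; have [Ac cx] := chart_atP A x0.
set c := chart_at A x0 in Ac cx *; pose y0 := cmap c x0.
pose psi z := phi z + - sqn (cmap c z - y0).
have cpen z : cdom c z -> mC1 A (fun z => - sqn (cmap c z - y0)) z.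
  by move=> cz; apply: mC1N; exact: mC1_penalty.
have epsi z : psi z = phi z - sqn (cmap c z - y0) by [].
have mpsi z : cdom c z -> mC1 A phi z -> mC1 A psi z.
  by move=> cz cp; exact: (mC1D cp (cpen _ cz)).
clearbody psi.
have cpsi0 := mpsi x0 cx cphi.
have epsi0 : psi x0 = phi x0 by rewrite epsi subrr sqn0 oppr0 addr0.
pose gap z := a - lam * (psi z - v z) - H z (dfun A psi z).
have cgap : {for x0, continuous gap}.
  have c1 : {for x0, continuous (fun z => a - lam * (psi z - v z))}.
    have cp := mC1_continuous cpsi0.
    exact: (cvgB (cvg_cst a) (cvgM (cvg_cst lam) (cvgB cp (cv x0)))).
  exact: (cvgB c1 (cH _ _ cpsi0)).
have egap z : gap z = a - lam * (psi z - v z) - H z (dfun A psi z) by [].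
clearbody gap.
have gap0 : 0 < gap x0.
  have h : \forall z \near x0, psi z <= phi z.
    by apply: filterE => z; rewrite epsi gerDl oppr_le0 sqn_ge0.
  by rewrite egap (dfun_le cpsi0 cphi epsi0 h) epsi0 e0 subr_gt0.
have [eta eta0 eta1] : exists2 eta, 0 < eta & eta < gap x0.
  by exists (gap x0 / 2); lra.
have ngap : \forall z \near x0, eta < gap z by exact: (cvgr_gt _ cgap _ eta1).
have good : \forall y \near y0, [/\ cdom c (cinv c y), cmap c (cinv c y) = y,
    phi (cinv c y) <= u (cinv c y), eta < gap (cinv c y) &
    mC1 A phi (cinv c y)].
  have n1 := nbhs_cimg cx; have n2 := nbhs_cinv cx ngap.
  have n3 := nbhs_cinv cx uphi; have n4 := nbhs_cinv cx (mC1_near cphi).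
  near=> y; split; [by have [] := near n1 y|by have [] := near n1 y
    |by near: y|by near: y|by near: y].
have [r r0 gr] := nbhs_sqn good.
have r20 : 0 < r ^+ 2 by rewrite exprn_gt0.
(* The first bound puts [psi + d] below [u] where |y - y0|^2 >= r^2 / 2, so the bump stays in [K];
   the second keeps lam d, the drop of the right-hand side under the shift, below the gap. *)
pose d := Num.min (r ^+ 2 / 2) (eta / (lam + 1)).
have lp : 0 < lam + 1 by lra.
have d0 : 0 < d by rewrite lt_min !divr_gt0.
have dr : d <= r ^+ 2 / 2 by rewrite ge_min lexx.
have ld : lam * d <= eta.
  have : d * (lam + 1) <= eta by rewrite -ler_pdivlMr// ge_min lexx orbT.
  by nra.
(* The maximum is taken on the large ball [P], but [w = u] already outside the smaller ball [K]. As
   [K] is closed and lies in the interior of [P], one of the two descriptions of [w] holds near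
   every point. *)
pose P z := `[< cdom c z /\ sqn (cmap c z - y0) <= r ^+ 2 >].
pose w z := if P z then Num.max (u z) (psi z + d) else u z.
have uw z : u z <= w z by rewrite /w; case: ifP => // _; rewrite le_max lexx.
pose K := cinv c @` [set y : 'rV[R]_n | sqn (y - y0) <= r ^+ 2 / 2].
clearbody d.
have r2r : r ^+ 2 / 2 <= r ^+ 2 by lra.
have clK : closed K.
  apply: compact_closed => //; apply: continuous_compact; last exact: sqn_ball_compact.
  rewrite continuous_subspace_in => y yB; rewrite inE in yB.
  have [cy ey _ _ _] := gr y (le_trans yB r2r).
  apply: continuous_subspaceT_for => //; apply: cinv_continuous.
  by exists (cinv c y).
have wnK z : ~ K z -> w z = u z.
  move=> nK; rewrite /w /P; case: asboolP => // -[cz zr]; rewrite max_l//.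
  have [_ _ ple _ _] := gr _ zr; rewrite cmapK// in ple.
  have : r ^+ 2 / 2 < sqn (cmap c z - y0).
    rewrite ltNge; apply/negP => h; apply: nK; exists (cmap c z) => //.
    by rewrite cmapK.
  by rewrite epsi; move: ple dr; lra.
have KP x : K x -> [/\ P x, \forall z \near x, P z, mC1 A psi x & eta < gap x].
  move=> [y yB <-]; have [cy ey _ gy py] := gr y (le_trans yB r2r).
  have ylt : sqn (cmap c (cinv c y) - y0) < r ^+ 2.
    by rewrite ey; apply: le_lt_trans yB _; lra.
  have nP : \forall z \near cinv c y, P z.
    have nl : \forall t \near cmap c (cinv c y), sqn (t - y0) < r ^+ 2.
      exact: (cvgr_lt _ (@sqn_continuous _ _ y0 _) _ ylt).
    by apply: filterS2 (nbhs_cdom cy) (nbhs_cmap cy nl) => z cz /ltW zr; apply/asboolP.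
  split; [exact: nbhs_singleton nP|exact: nP|exact: (mpsi _ cy py)|exact: gy].
have cw : continuous w.
  move=> x; have [Kx|nKx] := pselect (K x); last first.
    have nnK : \forall z \near x, ~ K z.
      by apply: open_nbhs_nbhs; split => //; exact: closed_openC.
    apply: (@near_eq_continuous _ _ u); last exact: (cu x).
    by apply: filterS nnK => z /wnK ->.
  have [_ nP cpsi _] := KP x Kx.
  have c1 : {for x, continuous (fun z => psi z + d)}.
    exact: (cvgD (mC1_continuous cpsi) (cvg_cst d)).
  have c2 : {for x, continuous (fun z => Num.max (u z) (psi z + d))}.
    exact: (continuous_max (cu x) c1).
  apply: near_eq_continuous c2.
  by apply: filterS nP => z Pz; rewrite /w Pz.
have sw : lsub H w (fun x => a - lam * (w x - v x)).
  split => // x phi' cphi' e' wphi'.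
  have ule : w x = u x -> H x (dfun A phi' x) <= a - lam * (w x - v x).
    move=> ewu; rewrite ewu; apply: su => //; first by rewrite e'.
    by apply: filterS wphi' => z; apply: le_trans.
  have [Kx|nKx] := pselect (K x); last exact: ule (wnK x nKx).
  have [Px nP cpsi gx] := KP x Kx.
  have ew : w x = Num.max (u x) (psi x + d) by rewrite /w Px.
  have [h|h] := leP (psi x + d) (u x); first by apply: ule; rewrite ew max_l.
  have {}ew : w x = psi x + d by rewrite ew max_r// ltW.
  have cd : mC1 A (cst d) x by exact: mC1_cst.
  have <- : dfun A (fun z => psi z + cst d z) x = dfun A phi' x.
    apply: (dfun_le (mC1D cpsi cd) cphi'); first by rewrite e' ew.
    apply: filterS2 nP wphi' => z Pz; apply: le_trans.
    by rewrite /w Pz le_max lexx orbT.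
  rewrite (dfunD cpsi cd) dfun_cst addr0 ew.
  have -> : psi x + d - v x = (psi x - v x) + d by rewrite addrAC.
  by rewrite mulrDr; move: gx ld; rewrite egap; clear; lra.
have := umax w sw uw x0.
have [Px0 _ _ _] : [/\ P x0, \forall z \near x0, P z, mC1 A psi x0 & eta < gap x0].
  apply: KP; exists y0; last by rewrite /y0 cmapK.
  by rewrite /= subrr sqn0 divr_ge0// ltW.
by rewrite /w Px0 ge_max lexx epsi0 e0 /= leNgt ltrDl d0.
Unshelve. all: by end_near. Qed.

End Perron.

(** * Global and local test functions *)

Section GlobalTests.
Context {R : realType} {n : nat} {M : topologicalType}.
Variable A : smooth_atlas R n M.
Hypothesis hT2 : hausdorff_space M.
Implicit Types (c d : chart R n M) (x z : M) (phi psi w : M -> R) (H : hamiltonian A).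

(** A coordinate cutoff extended by zero; the extension is C^1 because the coordinate ball is
    compact, hence closed in the Hausdorff space [M]. The last clause lets [chi] multiply a function
    known to be C^1 only on [V]. *)
Lemma manifold_plateau x (V : set M) : nbhs x V -> exists chi : M -> R,
  [/\ forall z, mC1 A chi z, forall z, 0 <= chi z <= 1,
    \forall z \near x, chi z = 1 &
    forall z, V z \/ \forall z' \near z, chi z' = 0].
Proof.
move=> nV; have [Ac cx] := chart_atP A x; set c := chart_at A x in Ac cx *.
pose y0 := cmap c x.
have good : \forall y \near y0, [/\ cdom c (cinv c y), cmap c (cinv c y) = y &
    V (cinv c y)].
  have n1 := nbhs_cimg cx; have n2 := nbhs_cinv cx nV.
  by near=> y; split; [have [] := near n1 y|have [] := near n1 y|near: y].
have [r r0 gr] := nbhs_sqn good.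
have r20 : 0 < r ^+ 2 / 2 by rewrite divr_gt0// exprn_gt0.
pose K := cinv c @` [set y : 'rV[R]_n | sqn (y - y0) <= r ^+ 2].
have clK : closed K.
  apply: compact_closed => //; apply: continuous_compact; last exact: sqn_ball_compact.
  rewrite continuous_subspace_in => y yB; rewrite inE in yB.
  have [cy ey _] := gr y yB.
  apply: continuous_subspaceT_for => //; apply: cinv_continuous.
  by exists (cinv c y).
pose b := plateau y0 (r ^+ 2 / 2).
pose chi z := if `[< cdom c z >] then b (cmap c z) else 0.
have chi_in z : cdom c z -> chi z = b (cmap c z).
  by move=> cz; rewrite /chi; case: asboolP.
have chi_out z : ~ K z -> chi z = 0.
  move=> nK; rewrite /chi; case: asboolP => // cz; apply: plateau_out => //.
  rewrite mulrC divfK// leNgt; apply/negP => /ltW h; apply: nK.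
  by exists (cmap c z) => //; rewrite cmapK.
have nK z : ~ K z -> \forall z' \near z, chi z' = 0.
  move=> nKz; have : \forall z' \near z, ~ K z'.
    by apply: open_nbhs_nbhs; split => //; exact: closed_openC.
  by apply: filterS => z' /chi_out.
exists chi; split.
- move=> z; have [Kz|nKz] := pselect (K z); last first.
    have e : \forall z' \near z, cst 0 z' = chi z'.
      by apply: filterS (nK z nKz) => z' ->.
    exact: (mC1_eq e (@mC1_cst _ _ _ A 0 z)).
  have [y yB eyz] := Kz; have [cy _ _] := gr y yB; rewrite eyz in cy.
  have e : \forall z' \near z, (b \o cmap c) z' = chi z'.
    by apply: filterS (nbhs_cdom cy) => z' /chi_in ->.
  exact: (mC1_eq e (mC1_pull Ac cy (C1_plateau _ _ _))).
- move=> z; rewrite /chi; case: ifP => _; last by rewrite lexx ler01.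
  exact: plateau_itv.
- apply: filterS2 (nbhs_cdom cx) (nbhs_cmap cx (sqn_nbhs y0 r20)) => z cz /ltW zr.
  by rewrite chi_in//; exact: plateau_in.
- move=> z; have [[y yB <-]|nKz] := pselect (K z); last by right; exact: nK.
  by left; have [] := gr y yB.
Unshelve. all: by end_near. Qed.

Hypothesis hsc : @second_countable M.

(** A Lindelof argument: every point has a basic open set on which some cutoff is 1, and one cutoff
    is kept for each code of a basic set. The constant [a k] bounds [w] on the support because the
    cutoff lives where [w] is less than its value at the centre plus 1. *)
Lemma countable_plateaus w : continuous w -> exists (chi : nat -> M -> R) (a : nat -> R),
  [/\ forall k z, mC1 A (chi k) z, forall k z, 0 <= chi k z <= 1,
    forall k z, chi k z * w z <= chi k z * a k &
    forall z, exists k, \forall z' \near z, chi k z' = 1].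
Proof.
move=> cw.
have /choice[X hX] x : exists chi : M -> R, [/\ forall z, mC1 A chi z,
    forall z, 0 <= chi z <= 1, \forall z \near x, chi z = 1 &
    forall z, chi z * w z <= chi z * (w x + 1)].
  have nV : \forall z \near x, w z < w x + 1.
    by apply: (cvgr_lt _ (cw x)); rewrite ltrDl.
  have [chi [c1 c2 c3 c4]] := manifold_plateau nV; exists chi; split => // z.
  have [/= h|h] := c4 z; last by rewrite (nbhs_singleton h) !mul0r.
  by apply: ler_wpM2l (ltW h); have /andP[] := c2 z.
have [B /countable_injP[f finj] [Bo Bb]] := hsc.
pose Q k x := exists b, [/\ B b, f b = k & b `<=` [set z | X x z = 1]].
have /choice[s hs] k : exists o : option M,
    (forall x, o = Some x -> Q k x) /\ (o = None -> forall x, ~ Q k x).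
  have [[x Qx]|nQ] := pselect (exists x, Q k x).
    by exists (Some x); split => // _ [<-].
  by exists None; split => // _ x Qx; apply: nQ; exists x.
exists (fun k => if s k is Some x then X x else cst 0).
exists (fun k => if s k is Some x then w x + 1 else 0); split.
- move=> k z; case: (s k) => [x|]; first by have [+ _ _ _] := hX x; exact.
  exact: mC1_cst.
- move=> k z; case: (s k) => [x|]; first by have [_ + _ _] := hX x; exact.
  by rewrite lexx ler01.
- move=> k z; case: (s k) => [x|]; first by have [_ _ _ +] := hX x; exact.
  by rewrite !mul0r.
- move=> z; have [_ _ nz _] := hX z.
  have [b [Bz bz] bX] := Bb z _ nz.
  exists (f b); have [hs1 hs2] := hs (f b); case E : (s (f b)) => [x|]; last first.
    by exfalso; apply: (hs2 E z); exists b.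
  have [b' [Bb' fb' b'X]] := hs1 x E.
  have eb : b' = b by apply: finj; rewrite ?inE.
  rewrite eb in b'X; have nb : nbhs z b by apply: open_nbhs_nbhs; split => //; exact: Bo.
  by apply: filterS nb.
Qed.

(** Extends the germ of a test function to a global C^1 majorant of [u], by gluing it to the upper
    bounds [a k] of [u] with a partition of unity. *)
Lemma global_test u phi x : continuous u -> mC1 A phi x -> phi x = u x ->
  (\forall z \near x, u z <= phi z) ->
  exists Phi : M -> R, [/\ C1_function A Phi, forall z, u z <= Phi z &
    \forall z \near x, Phi z = phi z].
Proof.
move=> cu cphi e0 uphi.
have [chi [a [c1 c2 c3 c4]]] := countable_plateaus cu.
have [chi0 [d1 d2 d3 d4]] := manifold_plateau (filterI (mC1_near cphi) uphi).
(* [Phi] is the locally finite sum of [chi0 * phi] and of the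
   [a k * chi k * P k], where [P k = (1 - chi0) \prod_(j < k) (1 - chi j)]. *)
pose P := fix P k z : R := if k is k'.+1 then P k' z * (1 - chi k' z)
  else 1 - chi0 z.
pose S := fix S k z : R := if k is k'.+1 then S k' z + a k' * (chi k' z * P k' z)
  else chi0 z * phi z.
have P0 k z : 0 <= P k z.
  elim: k => [|k IH] /=; first by have /andP[_] := d2 z; rewrite subr_ge0.
  by rewrite mulr_ge0// subr_ge0; have /andP[] := c2 k z.
have mP k z : mC1 A (P k) z.
  elim: k => [|k IH] /=.
    exact: (mC1D (@mC1_cst _ _ _ A 1 z) (mC1N (d1 z))).
  exact: (mC1M IH (mC1D (@mC1_cst _ _ _ A 1 z) (mC1N (c1 k z)))).
have mS k z : mC1 A (S k) z.
  elim: k => [|k IH] /=.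
    have [[cz _]|h] := d4 z; first exact: (mC1M (d1 z) cz).
    have e : \forall z' \near z, cst 0 z' = chi0 z' * phi z'.
      by apply: filterS h => z' ->; rewrite mul0r.
    exact: (mC1_eq e (@mC1_cst _ _ _ A 0 z)).
  exact: (mC1D IH (mC1M (@mC1_cst _ _ _ A (a k) z) (mC1M (c1 k z) (mP k z)))).
(* The weights used in [S k] telescope to [1 - P k], and each of them multiplies a value at least
   [u] wherever it is nonzero. *)
have SP k z : (1 - P k z) * u z <= S k z.
  elim: k => [|k IH] /=.
    rewrite opprB addrC subrK; have [[_ /= h]|h] := d4 z.
      by apply: ler_wpM2l => //; have /andP[] := d2 z.
    by rewrite (nbhs_singleton h) !mul0r.
  have := c3 k z; have := P0 k z; move: IH.
  set p := P k z; set s := S k z; set h := chi k z; set ak := a k; set t := u z.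
  move=> h1 h2 h3; have : p * (h * t) <= p * (h * ak) by exact: ler_wpM2l.
  by clear -h1; lra.
(* Once the remaining weight [P k] is 0 the partial sums are stationary; hence [Phi] does not depend
   on the choice of [N z] and locally equals a single [S k]. *)
have stab k j z : P k z = 0 -> P (k + j)%N z = 0 /\ S (k + j)%N z = S k z.
  move=> Pk; elim: j => [|j [IH1 IH2]]; first by rewrite addn0.
  by rewrite addnS /= IH1 IH2 !(mul0r, mulr0) addr0.
have SS k l z : P k z = 0 -> P l z = 0 -> S k z = S l z.
  move=> Pk Pl; have [h|/ltnW h] := leqP k l.
    by rewrite -(subnKC h); have [_ ->] := stab k (l - k)%N z Pk.
  by rewrite -(subnKC h); have [_ ->] := stab l (k - l)%N z Pl.
have /choice[N hN] z : exists k, \forall z' \near z, P k z' = 0.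
  have [k hk] := c4 z; exists k.+1; apply: filterS hk => z' /= ->.
  by rewrite subrr mulr0.
pose Phi z := S (N z) z.
have PhiS z k : (\forall z' \near z, P k z' = 0) ->
    \forall z' \near z, S k z' = Phi z'.
  apply: filterS => z' Pk; apply: SS => //.
  exact: (nbhs_singleton (hN z')).
exists Phi; split.
- apply/C1_functionP => z; exact: (mC1_eq (PhiS z _ (hN z)) (mS _ z)).
- move=> z; have := SP (N z) z; rewrite (nbhs_singleton (hN z)) subr0 mul1r.
  by rewrite /Phi.
- have n0 : \forall z \near x, P 0%N z = 0.
    by apply: filterS d3 => z /= ->; rewrite subrr.
  apply: filterS2 d3 (PhiS x 0%N n0) => z e1 <- /=.
  by rewrite e1 mul1r.
Qed.

Lemma viscosity_subsolution_local H s u :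
  viscosity_subsolution H s u -> lsub H u (cst s).
Proof.
move=> [cu su]; split => // x phi cphi e0 uphi.
have [Phi [cPhi uPhi ePhi]] := global_test cu cphi e0 uphi.
have cx := (C1_functionP A Phi).1 cPhi x.
rewrite -(dfun_eq cx ePhi); apply: su => // z.
by rewrite (nbhs_singleton ePhi) e0 subrr subr_le0.
Qed.

Lemma local_viscosity_subsolution H s u :
  lsub H u (cst s) -> viscosity_subsolution H s u.
Proof.
move=> [cu su]; split => // phi x /C1_functionP cphi uphi.
have ck : mC1 A (cst (u x - phi x)) x by exact: mC1_cst.
rewrite -[dfun A phi x]addr0 -(@dfun_cst _ _ _ A (u x - phi x) x).
rewrite -(dfunD (cphi x) ck); apply: (su x _ (mC1D (cphi x) ck)).
  by rewrite /= addrC subrK.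
by apply: filterE => z /=; rewrite addrC -lerBlDr.
Qed.

Lemma local_viscosity_supersolution H s u :
  lsuper H u (cst s) -> viscosity_supersolution H s u.
Proof.
move=> [cu su]; split => // phi x /C1_functionP cphi uphi.
have ck : mC1 A (cst (u x - phi x)) x by exact: mC1_cst.
rewrite -[dfun A phi x]addr0 -(@dfun_cst _ _ _ A (u x - phi x) x).
rewrite -(dfunD (cphi x) ck); apply: (su x _ (mC1D (cphi x) ck)).
  by rewrite /= addrC subrK.
by apply: filterE => z /=; rewrite addrC -lerBrDr.
Qed.

End GlobalTests.

(** Replaces extraction of subsequences: a cluster point along an ultrafilter is a limit, so one
    filter serves all points of [M] simultaneously. *)
Lemma ultra_bounded_cvg (R : realType) (I : Type) (F : set_system I)
    (a : I -> R) (B : R) : UltraFilter F -> (forall i, `|a i| <= B) ->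
  exists l : R, a @ F --> l.
Proof.
move=> UF aB.
have [|l [_ al]] := @segment_compact R (- B) B (a @ F) _.
  have aK i : `[- B, B]%classic (a i) by rewrite /= in_itv /= -ler_norml.
  exact: (filterE _ aK).
exists l => U nU; have [//|FnU] := in_ultra_setVsetC (a @^-1` U) UF.
by have [t [nUt Ut]] := al (~` U) U FnU nU.
Qed.

(** * Group action and compactness of families of subsolutions *)

Section Families.
Context {R : realType} {n : nat} {M : topologicalType}.
Variable A : smooth_atlas R n M.
Implicit Types (c d : chart R n M) (x z : M) (phi psi w : M -> R) (H : hamiltonian A).

Lemma lsub_le H w (f h : M -> R) : (forall x, f x <= h x) -> lsub H w f ->
  lsub H w h.
Proof.
move=> fh [cw sw]; split => // x phi cphi e le.
exact: le_trans (sw x phi cphi e le) (fh x).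
Qed.

Lemma lsub_shift H w f (k : R) : lsub H w f -> lsub H (fun x => w x - k) f.
Proof.
move=> [cw sw]; split; first by move=> x; exact: (cvgB (cw x) (cvg_cst k)).
move=> x phi cphi e le; have ck : mC1 A (cst k) x by exact: mC1_cst.
rewrite -[dfun A phi x]addr0 -(@dfun_cst _ _ _ A k x) -(dfunD cphi ck).
apply: (sw x _ (mC1D cphi ck)); first by rewrite /= e subrK.
by apply: filterS le => z; rewrite lerBlDr.
Qed.

(** A test [phi] for [w \o f] at [x] becomes the test [phi \o f'] for [w] at [f x]; the chain rule
    gives the pullback of its differential, on which [preserves] applies. *)
Lemma lsub_act H w F (f f' : M -> M) : smooth_map A f -> smooth_map A f' ->
  cancel f f' -> cancel f' f -> preserves H f -> lsub H w F ->
  lsub H (w \o f) (F \o f).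
Proof.
move=> sf sf' fK f'K pH [cw sw]; split.
  by move=> x; apply: continuous_comp; [exact: sf.1|exact: cw].
move=> x phi cphi e le.
have c1 : mC1 A phi (f' (f x)) by rewrite fK.
have c2 := mC1_comp sf' c1.
have ep : (phi \o f') \o f = phi by apply/funext => z; rewrite /= fK.
rewrite -{1}ep (dfun_comp sf c2) -pH; apply: (sw _ _ c2); first by rewrite /= fK.
have le' : \forall z \near f x, (w \o f) (f' z) <= phi (f' z).
  have cf' : f' @ f x --> x by have := sf'.1 (f x); rewrite /continuous_at fK.
  exact: (cf' _ le).
by apply: filterS le' => z; rewrite /= f'K.
Qed.

(** Equicontinuity changes the bound by at most 1 between nearby points, so the set of points with a
    uniform bound is open and closed. *)
Lemma equicontinuous_bounded (T : set (M -> R)) : connected [set: M] ->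
  (forall x (e : R), 0 < e -> \forall z \near x, forall w, T w -> `|w z - w x| <= e) ->
  forall x0 x, exists B : R, forall w, T w -> `|w x - w x0| <= B.
Proof.
move=> cM eqT x0.
pose D := [set x | exists B : R, forall w, T w -> `|w x - w x0| <= B].
have step x z : (forall w, T w -> `|w z - w x| <= 1) -> (D x <-> D z).
  move=> h; split=> -[B hB]; exists (B + 1) => w Tw.
    by rewrite -(subrKA (w x)) addrC (le_trans (ler_normD _ _))// lerD// ?hB// h.
  rewrite -(subrKA (w z)) addrC (le_trans (ler_normD _ _))// lerD// ?hB//.
  by rewrite distrC h.
have oD : open D.
  rewrite openE => x Dx; apply: filterS (eqT x 1 ltr01) => z h.
  exact: (step x z h).1.
have oDc : open (~` D).
  rewrite openE => x nDx; apply: filterS (eqT x 1 ltr01) => z h Dz.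
  by apply: nDx; exact: (step x z h).2.
have DT : D = [set: M].
  apply: cM.
  - by exists x0, 0 => w _; rewrite subrr normr0.
  - by exists D => //; rewrite setTI.
  - exists D; last by rewrite setTI.
    by rewrite -[D]setCK; exact: open_closedC.
by move=> x; have : D x by rewrite DT.
Qed.

(** Ascoli's theorem modulo constants: values normalised at [x0] converge pointwise along an
    ultrafilter finer than [\oo], and equicontinuity upgrades this to locally uniform
    convergence. *)
Lemma lsub_compactness H (C : R) (w_ : nat -> M -> R) x0 : Hcoercive H ->
  connected [set: M] -> (forall k, lsub H (w_ k) (cst C)) ->
  exists (F : set_system nat) (w : M -> R),
    [/\ UltraFilter F, (forall P, (\forall k \near \oo, P k) -> F P), continuous w &
     forall x (e : R), 0 < e ->
       \forall z \near x & k \near F, `|w_ k z - w_ k x0 - w z| < e].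
Proof.
move=> coH cM sw.
have eqT x (e : R) : 0 < e -> \forall z \near x, forall w,
    [set w | lsub H w (cst C)] w -> `|w z - w x| <= e.
  by move=> e0; exact: lsub_equicontinuous.
have [F [UF Foo]] := @ultraFilterLemma nat \oo _.
have /choice[w hw] x : exists l : R, (fun k => w_ k x - w_ k x0) @ F --> l.
  have [B hB] := equicontinuous_bounded cM eqT x0 x.
  by apply: (@ultra_bounded_cvg _ _ _ _ B UF) => k; exact: (hB _ (sw k)).
have PF : ProperFilter F by exact: ultra_proper.
have eqw x (e : R) : 0 < e -> \forall z \near x, `|w z - w x| <= e.
  move=> e0; apply: filterS (eqT x e e0) => z hz.
  have cz : (fun k => `|(w_ k z - w_ k x0) - (w_ k x - w_ k x0)|) @ F --> `|w z - w x|.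
    exact: (cvg_norm (cvgB (hw z) (hw x))).
  rewrite leNgt; apply/negP => /(cvgr_gt _ cz)/filter_ex[k /=].
  apply/negP; rewrite -leNgt (_ : _ - _ = w_ k z - w_ k x); last ring.
  exact: (hz _ (sw k)).
exists F, w; split => //.
  move=> x; apply/cvgrPdist_le => e e0; apply: filterS (eqw x e e0) => z.
  by rewrite distrC.
move=> x e e0; have e3 : 0 < e / 4 by rewrite divr_gt0.
have nk : \forall k \near F, `|w x - (w_ k x - w_ k x0)| < e / 4.
  exact: ((cvgrPdist_lt _ _).1 (hw x) _ e3).
exists ([set z | (forall w, lsub H w (cst C) -> `|w z - w x| <= e / 4) /\ `|w z - w x| <= e / 4],
  [set k | `|w x - (w_ k x - w_ k x0)| < e / 4]).
  split; last exact: nk.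
  by apply: filterI; [exact: eqT|exact: eqw].
move=> [z k] /= [[h1 h2] h3].
have := h1 _ (sw k); move: h2 h3; rewrite !ler_norml !ltr_norml.
by move=> /andP[? ?] /andP[? ?] /andP[? ?]; apply/andP; split; lra.
Qed.

End Families.

(** * The discounted equation *)

Section Discounted.
Context {R : realType} {n : nat} {M : topologicalType}.
Variable A : smooth_atlas R n M.
Implicit Types (x z : M) (w : M -> R) (H : hamiltonian A).

(** [v] itself is a competitor since the discount term vanishes at [w = v]. [lsub_lower] bounds all
    competitors, so the supremum is finite; lying above [v], they are subsolutions at level [a],
    hence equicontinuous, and the supremum is continuous. *)
Lemma perron_discounted H v (a lam C0 : R) : hausdorff_space M -> Hcont H ->
  Hcoercive H -> (forall x p, C0 <= H x p) -> 0 < lam -> lsub H v (cst a) ->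
  exists u, [/\ lsub H u (fun x => a - lam * (u x - v x)),
    lsuper H u (fun x => a - lam * (u x - v x)), forall x, v x <= u x,
    forall x, lam * (u x - v x) <= a - C0 &
    forall w, lsub H w (fun x => a - lam * (w x - v x)) ->
      (forall x, v x <= w x) -> forall x, w x <= u x].
Proof.
move=> hT2 cH coH HC0 lam0 sv; have cv := sv.1; have lam0' := ltW lam0.
pose T := [set w | lsub H w (fun x => a - lam * (w x - v x)) /\
                   forall x, v x <= w x].
have Tv : T v.
  split; last by move=> x; exact: lexx.
  by apply: lsub_le sv => x; rewrite subrr mulr0 subr0 lexx.
have Tle w x : T w -> lam * (w x - v x) <= a - C0.
  move=> [sw vw].
  have cf : continuous (fun x => a - lam * (w x - v x)).
    move=> z; exact: (cvgB (cvg_cst a) (cvgM (cvg_cst lam) (cvgB (sw.1 z) (cv z)))).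
  by have := lsub_lower HC0 sw cf x; lra.
have Ta w : T w -> lsub H w (cst a).
  move=> [sw vw]; apply: lsub_le sw => x.
  by rewrite /= gerBl mulr_ge0// subr_ge0.
have wub w x : T w -> w x <= v x + (a - C0) / lam.
  by move=> /(Tle _ x) h; rewrite -lerBlDl ler_pdivlMr// mulrC.
pose V x := [set w x | w in T].
have V0 x : V x !=set0 by exists (v x), v.
have Vub x : has_ubound (V x).
  by exists (v x + (a - C0) / lam) => _ [w Tw <-]; exact: wub.
pose u x := sup (V x).
have uge w x : T w -> w x <= u x by move=> Tw; apply: ub_le_sup => //; exists w.
have uadh x (e : R) : 0 < e -> exists2 w, T w & u x - e < w x.
  by move=> e0; have [_ [w Tw <-] h] := sup_adherent e0 (conj (V0 x) (Vub x)); exists w.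
have cu : continuous u.
  move=> x; apply/cvgrPdist_le => e e0.
  apply: filterS (lsub_equicontinuous a x coH e0) => z hz.
  have uz y y' : (forall w, T w -> `|w y - w y'| <= e) -> u y <= u y' + e.
    move=> h; apply: ge_sup => // _ [w Tw <-].
    have := uge w y' Tw; have := h w Tw; rewrite ler_norml => /andP[_]; lra.
  have h1 : u z <= u x + e by apply: uz => w /Ta; exact: hz.
  have h2 : u x <= u z + e by apply: uz => w /Ta; rewrite distrC; exact: hz.
  by rewrite ler_norml; apply/andP; split; lra.
have su : lsub H u (fun x => a - lam * (u x - v x)).
  by apply: (@lsub_sup _ _ _ _ T) => // w [].
have vu x : v x <= u x by exact: uge.
have umax w : lsub H w (fun x => a - lam * (w x - v x)) ->
    (forall x, v x <= w x) -> forall x, w x <= u x.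
  by move=> sw vw x; exact: uge.
exists u; split => //.
- apply: lsuper_maximal => // w sw uw x; apply: umax => // z.
  exact: le_trans (vu z) (uw z).
- by move=> x; apply: Tle.
Qed.

Lemma lsub_limit_cst H (w_ : nat -> M -> R) (c_ : nat -> R) (c : R)
    (F : set_system nat) w x0 : ProperFilter F -> Hcont H ->
  (forall k, lsub H (w_ k) (cst (c_ k))) -> continuous w ->
  (forall x (e : R), 0 < e ->
     \forall z \near x & k \near F, `|w_ k z - w_ k x0 - w z| < e) ->
  (forall e : R, 0 < e -> \forall k \near F, c_ k < c + e) ->
  lsub H w (cst c).
Proof.
move=> PF cH sw cw hw hc; split => // x.
apply: (@lsub_limit _ _ _ _ _ F _ _ (fun k z => w_ k z - w_ k x0)
  (fun k => cst (c_ k))) => //.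
  by move=> k; exact: lsub_shift.
move=> e e0; exists (setT, [set k | c_ k < c + e]).
  by split; [exact: filterT|exact: hc].
by move=> [z k] [_ /= h].
Qed.

(** The normalising constant [w_ k x0] is the same at [x] and [f x], so invariance survives the
    normalisation. *)
Lemma near_limit_eq (F : set_system nat) (w_ : nat -> M -> R) w x0 (f : M -> M) :
  ProperFilter F ->
  (forall x (e : R), 0 < e ->
     \forall z \near x & k \near F, `|w_ k z - w_ k x0 - w z| < e) ->
  (forall k x, w_ k (f x) = w_ k x) -> forall x, w (f x) = w x.
Proof.
move=> PF hw wf x; apply/eqP; rewrite -subr_eq0 -normr_le0 leNgt; apply/negP => e0.
have e2 : 0 < `|w (f x) - w x| / 2 by rewrite divr_gt0.
have pt z : \forall k \near F, `|w_ k z - w_ k x0 - w z| < `|w (f x) - w x| / 2.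
  have [[U V] [/= nU FV] UV] := hw z _ e2; apply: filterS FV => k Vk.
  by apply: (UV (z, k)); split => //; exact: nbhs_singleton nU.
have [k [h1 h2]] := filter_ex (filterI (pt x) (pt (f x))).
move: h1 h2; rewrite /= wf.
set p := w_ k x - w_ k x0; rewrite (distrC p (w (f x))) => h1 h2.
have := ler_normD (w (f x) - p) (p - w x); rewrite subrKA; lra.
Qed.

End Discounted.

Lemma near_natSinv_lt (R : realType) (e : R) : 0 < e ->
  \forall k \near \oo, k.+1%:R^-1 < e :> R.
Proof. by move=> e0; exact: (near_infty_natSinv_lt (PosNum e0)). Qed.

(** * The vanishing discount limit *)

Section WeakKAM.
Context {R : realType} {n : nat} {M : topologicalType}.
Variable A : smooth_atlas R n M.
Implicit Types (x z : M) (w : M -> R) (H : hamiltonian A).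

Lemma ergodic_limit H v (c C0 : R) x0 : hausdorff_space M ->
  connected [set: M] -> Hcont H -> Hcoercive H -> (forall x p, C0 <= H x p) ->
  lsub H v (cst c) ->
  exists (w : M -> R) (b : R), [/\ 0 <= b, lsub H w (cst (c - b)),
    lsuper H w (cst (c - b)) &
    forall f f' : M -> M, smooth_map A f -> smooth_map A f' -> cancel f f' ->
      cancel f' f -> preserves H f -> preserves H f' ->
      (forall x, v (f x) = v x) -> forall x, w (f x) = w x].
Proof.
move=> hT2 cM cH coH HC0 sv; have cv := sv.1.
pose lam (k : nat) : R := k.+1%:R^-1.
have lam0 k : 0 < lam k by rewrite invr_gt0 ltr0Sn.
have /choice[u hu] k := perron_discounted hT2 cH coH HC0 (lam0 k) sv.
have vu k x : v x <= u k x by have [_ _ + _ _] := hu k; exact.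
have su k : lsub H (u k) (cst c).
  have [+ _ _ _ _] := hu k; apply: lsub_le => x /=.
  by rewrite gerBl mulr_ge0// ?subr_ge0// ltW.
have [F [w [UF Foo cw hw]]] := lsub_compactness x0 coH cM su.
have PF : ProperFilter F by exact: ultra_proper.
pose al k := lam k * (u k x0 - v x0).
have al0 k : 0 <= al k by rewrite mulr_ge0 ?subr_ge0// ltW.
have [b hb] : exists b : R, al @ F --> b.
  apply: (@ultra_bounded_cvg _ _ _ _ (c - C0) UF) => k.
  by rewrite ger0_norm//; have [_ _ _ + _] := hu k; exact.
have b0 : 0 <= b.
  rewrite leNgt; apply/negP => /(cvgr_lt _ hb)/filter_ex[k /=].
  by apply/negP; rewrite -leNgt.
pose f k z := c - lam k * (u k z - v z).
(* The discount term splits into its value at [x0], which converges to [b], and lam times a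
   difference that stays bounded near each point. *)
have fE k z : f k z = c - al k - lam k * ((u k z - u k x0) - (v z - v x0)).
  by rewrite /f /al; ring.
have hf x (e : R) : 0 < e ->
    \forall z \near x & k \near F, `|f k z - (c - b)| < e.
  (* Bounds the bracket of [fE] near [x]: 1 for the variation of [w], 1 for the distance of the
     normalised [u k] to [w], and 1 for the variation of [v]. *)
  move=> e0; pose B := `|w x| + 1 + 1 + (`|v x| + 1 + `|v x0|).
  have B0 : 0 < B by rewrite /B ltr_pwDl ?addr_ge0// ltr_pwDr ?addr_ge0.
  have n1 : \forall z \near x, `|w z - w x| < 1.
    exact: ((cvgrPdistC_lt _ _).1 (cw x) _ ltr01).
  have n2 : \forall z \near x, `|v z - v x| < 1.
    exact: ((cvgrPdistC_lt _ _).1 (cv x) _ ltr01).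
  have [[U V] [/= nU FV] UV] := hw x 1 ltr01.
  have e2 : 0 < e / 2 by rewrite divr_gt0.
  have k1 : \forall k \near F, `|b - al k| < e / 2.
    exact: ((cvgrPdist_lt _ _).1 hb _ e2).
  have k2 : \forall k \near F, lam k < e / 2 / B.
    by apply: Foo; apply: near_natSinv_lt; rewrite divr_gt0.
  exists (U `&` [set z | `|w z - w x| < 1 /\ `|v z - v x| < 1],
     V `&` [set k | `|b - al k| < e / 2 /\ lam k < e / 2 / B]).
    by split; apply: filterI => //; apply: filterI.
  move=> [z k] [/= [Uz [wz vz]] [Vk [bk lk]]].
  have := UV (z, k) (conj Uz Vk); rewrite /= => uk.
  rewrite fE; set s := (u k z - u k x0) - (v z - v x0).
  have sB : `|s| <= B.
    have nw := normr_ge0 (w x); move: wz vz uk; rewrite /B /s.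
    have := ler_norm (w x); have := ler_norm (- w x); have := ler_norm (v x).
    have := ler_norm (- v x); have := ler_norm (v x0); have := ler_norm (- v x0).
    rewrite !normrN ler_norml !ltr_norml => ? ? ? ? ? ? /andP[? ?] /andP[? ?] /andP[? ?].
    by apply/andP; split; lra.
  have ls : `|lam k * s| < e / 2.
    rewrite normrM gtr0_norm//; apply: le_lt_trans (_ : lam k * B < _).
      by rewrite ler_pM2l.
    by rewrite -ltr_pdivlMr.
  move: bk ls; rewrite !ltr_norml => /andP[? ?] /andP[? ?].
  by apply/andP; split; lra.
have lsubw x : lsub_at H w x (c - b).
  apply: (@lsub_limit _ _ _ _ _ F _ _ (fun k z => u k z - u k x0) f) => //.
    by move=> k; apply: lsub_shift; have [+ _ _ _ _] := hu k; exact.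
  move=> e e0; have [UV hUV hlt] := hf x e e0; exists UV => // p /hlt /=.
  by rewrite ltr_norml => /andP[_]; rewrite ltrBlDr addrC.
have lsupw x : lsuper_at H w x (c - b).
  apply: lsuper_opp_at.
  apply: (@lsub_limit _ _ _ _ _ F _ _ (fun k z => - u k z - - u k x0)
    (fun k z => - f k z)) => //.
  - exact: Hcont_opp.
  - move=> k; apply: lsub_shift; apply: (@lsub_opp _ _ _ _ H).
    by have [_ + _ _ _] := hu k; exact.
  - move=> z e e0; have [UV hUV hlt] := hw z e e0; exists UV => // p /hlt /=.
    by rewrite -opprD -opprD normrN.
  - move=> e e0; have [UV hUV hlt] := hf x e e0; exists UV => // p /hlt /=.
    by rewrite ltr_norml => /andP[? _]; lra.
exists w, b; split => // g g' sg sg' gK g'K pg pg' vg.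
apply: (near_limit_eq PF hw) => k x.
have [_ _ _ _ umax] := hu k; have [sk _ _ _ _] := hu k.
(* [u k \o h] is again a subsolution above [v], so maximality gives one inequality; applying it to
   the inverse map gives the other. *)
have le h h' : smooth_map A h -> smooth_map A h' -> cancel h h' ->
    cancel h' h -> preserves H h -> (forall x, v (h x) = v x) ->
    forall x, u k (h x) <= u k x.
  move=> sh sh' hK h'K ph vh z; apply: (umax (u k \o h)); last first.
    by move=> y /=; rewrite -{1}vh; exact: vu.
  have := lsub_act sh sh' hK h'K ph sk; apply: lsub_le => y.
  by rewrite /= vh.
have vg' y : v (g' y) = v y by rewrite -{2}(g'K y) vg.
apply: le_anti; rewrite (le g g')//=.
by have := le g' g sg' sg g'K gK pg' vg' (g x); rewrite gK.
Qed.

End WeakKAM.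

Theorem theorem1p3 (R : realType) (n : nat) (M : topologicalType)
    (A : smooth_atlas R n M)
    (hT2 : hausdorff_space M) (hsc : @second_countable M)
    (hne : [set: M] !=set0) (hconn : connected [set: M])
    (g : riemannian_metric A) (hg : complete_metric g)
    (H : hamiltonian A)
    (hC2 : C2_hamiltonian H)
    (hsl : uniformly_superlinear H g)
    (hub : uniformly_bounded H g)
    (hcv : C2_strictly_convex H)
    (G : groupType) (act : G -> M -> M)
    (hact : is_group_action act)
    (hdiff : forall a : G, diffeomorphism A (act a))
    (hpres : forall a : G, preserves H (act a)) :
  exists c_inv : R,
    (exists u : M -> R,
       invariant_function act u /\ viscosity_solution H c_inv u) /\
    (forall c : R, c < c_inv ->
       ~ exists u : M -> R,
           invariant_function act u /\ viscosity_solution H c u).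
Proof.
have [x0 _] := hne.
have cH := C2_Hcont hC2; have coH := superlinear_coercive hsl.
have [C0 HC0] := superlinear_lower hsl; have [A0 HA0] := bounded_upper hub.
have act_inv a : [/\ smooth_map A (act a), smooth_map A (act a^-1%g),
    cancel (act a) (act a^-1%g) & cancel (act a^-1%g) (act a)].
  split; [exact: (hdiff a).1|exact: (hdiff _).1|move=> x|move=> x];
    by rewrite -hact.2 ?mulVg ?mulgV hact.1.
pose E := [set c | exists w : M -> R,
  invariant_function act w /\ lsub H w (cst c)].
have E0 : E !=set0.
  (* A test function touching a constant has zero differential, so an upper bound of H(x, 0) is an
     admissible level. *)
  exists A0, (cst 0); split => //; split; first by move=> x; exact: cvg_cst.
  move=> x phi cphi e le.
  rewrite -(dfun_le (@mC1_cst _ _ _ A 0 x) cphi (esym e) le) dfun_cst.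
  exact: HA0.
have Elb : lbound E C0.
  move=> c [w [_ sw]]; apply: (lsub_lower HC0 sw) => //.
  by move=> x; exact: cvg_cst.
have hE : has_lbound E by exists C0.
pose c0 := inf E.
(* Almost optimal subsolutions all lie at level at most c0 + 1, which gives compactness; their
   levels tend to [c0] along the ultrafilter. *)
have [v [vinv sv]] : E c0.
  have /choice[w_ hw_] k : exists w : M -> R, invariant_function act w /\
      lsub H w (cst (c0 + k.+1%:R^-1)).
    have k0 : 0 < k.+1%:R^-1 :> R by rewrite invr_gt0 ltr0Sn.
    have [c [w [winv sw]] /ltW ck] := inf_adherent k0 (conj E0 hE).
    by exists w; split => //; apply: lsub_le sw.
  have sw k : lsub H (w_ k) (cst (c0 + 1)).
    apply: lsub_le (hw_ k).2 => x /=.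
    by rewrite lerD2l invf_le1 ?ltr0Sn// ler1n.
  have [F [w [UF Foo cw hw]]] := lsub_compactness x0 coH hconn sw.
  have PF : ProperFilter F by exact: ultra_proper.
  exists w; split.
    by move=> a; apply: (near_limit_eq PF hw) => k; exact: (hw_ k).1.
  apply: (lsub_limit_cst PF cH (fun k => (hw_ k).2) cw hw) => e e0.
  apply: Foo; apply: filterS (near_natSinv_lt e0) => k.
  by rewrite ltrD2l.
have [w [b [b0 sw Sw winv]]] := ergodic_limit x0 hT2 hconn cH coH HC0 sv.
have {}winv : invariant_function act w.
  move=> a; have [s s' K K'] := act_inv a.
  exact: (winv _ _ s s' K K' (hpres a) (hpres _) (vinv a)).
have eb : c0 - b = c0.
  apply/eqP; rewrite eq_le gerBl b0 /=.
  by apply: ge_inf => //; exists w.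
rewrite eb in sw Sw; exists c0; split.
  exists w; split => //; split; first exact: local_viscosity_subsolution.
  exact: local_viscosity_supersolution.
(* A solution is in particular a subsolution, and once its tests are localised its level belongs to
   [E]. *)
move=> c cc0 [u [uinv [su _]]]; move: cc0; apply/negP; rewrite -leNgt.
apply: ge_inf => //; exists u; split => //.
exact: viscosity_subsolution_local hT2 hsc _ _ _ su.
Qed.
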